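(* Let $\ell\ge5$ be prime and let $j$ be an integer. Suppose that either $\ell\equiv 7,13\pmod{24}$ and $\left(\frac{3j}{\ell}\right)=-1$, or $\ell\not\equiv7,13\pmod{24}$ and $\ell\nmid j$. Then for every integer $n\ge 0$: (1) If $j$ is odd, then $$\mathrm{ou}^*\left(4\ell^2n+2j\ell+\tfrac{8\ell^2+1}{3}\right) \equiv 0\pmod 4.$$ (2) If $j$ is even, then $$\mathrm{ou}^*\left(4\ell^2n+2j\ell+\tfrac{2\ell^2+1}{3}\right) \equiv 0\pmod 4.$$
   Context: An odd strongly unimodal sequence of weight $n$ is a sequence of odd positive integers of the form $a_1<\cdots<a_r<c>b_1>\cdots>b_s$ (with $r,s\ge 0$) such that $n=c+\sum_{j=1}^r a_j+\sum_{j=1}^s b_j$. $\mathrm{ou}^*(n)$ denotes the number of odd strongly unimodal sequences of weight $n$ (so $\mathrm{ou}^*(n)=0$ for $n\le0$). $\left(\frac{\cdot}{\ell}\right)$ is the Legendre symbol. *)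

(* Defs.v *)
From mathcomp Require Import all_boot all_order all_algebra.

Set Implicit Arguments.
Unset Strict Implicit.
Unset Printing Implicit Defensive.

(* The peak c is the entry at index k: take k.+1 s is a_1, ..., a_r, c and
   drop k s is c, b_1, ..., b_s (see odd_strongly_unimodalP). *)
Definition odd_strongly_unimodal (s : seq nat) : bool :=
  all odd s &&
  [exists k : 'I_(size s), sorted ltn (take k.+1 s) && sorted gtn (drop k s)].

Lemma odd_strongly_unimodalP (s : seq nat) :
  reflect (all odd s /\ exists a c b,
             [/\ s = a ++ c :: b, sorted ltn (rcons a c) & sorted gtn (c :: b)])
          (odd_strongly_unimodal s).
Proof.
apply: (iffP andP) => -[odd_s unim_s]; split=> //.
  case/existsP: unim_s => k /andP[inc dec].
  exists (take k s), (nth 0 s k), (drop k.+1 s).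
  by rewrite -drop_nth // -take_nth // cat_take_drop.
have [a [c [b [def_s inc dec]]]] := unim_s.
have lt_as : size a < size s by rewrite def_s size_cat /= -addSnnS leq_addr.
apply/existsP; exists (Ordinal lt_as).
by rewrite /= (take_nth c) // def_s take_size_cat // drop_size_cat //
  nth_cat ltnn subnn inc.
Qed.

(* The entries are positive with sum n, so none of them, nor their number,
   exceeds n: the finite type n.-bseq 'I_n.+1 contains every such sequence. *)
Definition ou_star_nat (n : nat) : nat :=
  #|[set t : n.-bseq 'I_n.+1 |
      odd_strongly_unimodal (map val t) && (sumn (map val t) == n)]|.

Definition ou_star (n : int) : nat := if n is Posz m then ou_star_nat m else 0.

Lemma ou_star_size (n : int) (S : seq (seq nat)) :
    uniq S ->
    (forall s, s \in S <-> odd_strongly_unimodal s /\ n = Posz (sumn s)) ->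
  ou_star n = size S.
Proof.
move=> uniq_S mem_S; case: n mem_S => [n|n] mem_S; last first.
  by case: S {uniq_S} mem_S => // s S /(_ s)[]; rewrite mem_head => -[].
pose f (t : n.-bseq 'I_n.+1) := map val t.
have f_inj : injective f by move=> t u /(inj_map val_inj)/val_inj.
rewrite /ou_star /ou_star_nat cardE -(size_map f).
apply/perm_size/uniq_perm => // [|s]; first by rewrite map_inj_uniq ?enum_uniq.
apply/mapP/idP => [[t] | /mem_S[osu_s [def_n]]].
  by rewrite mem_enum inE => /andP[osu_t /eqP sum_t] ->; apply/mem_S; rewrite sum_t.
have bnd : all (fun x => x <= n) s && (size s <= n).
  have /andP[odd_s _] := osu_s.
  rewrite def_n; elim: (s) odd_s => //= x s' IH /andP[odd_x /IH/andP[bs' sz]].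
  rewrite leq_addr /=; apply/andP; split.
    by apply: sub_all bs' => y /leq_trans; apply; apply: leq_addl.
  by rewrite -add1n leq_add // odd_gt0.
have /andP[le_s sz_s] := bnd.
have def_s : map val (map (@inord n) s) = s.
  rewrite -map_comp -[RHS]map_id; apply/eq_in_map => x /(allP le_s) lexn.
  exact: inordK.
have sz' : size (map (@inord n) s) <= n by rewrite size_map.
exists (Bseq sz') => /=; last by rewrite /f /= def_s.
by rewrite mem_enum inE /= def_s osu_s -def_n eqxx.
Qed.

Definition legendre (a : int) (p : nat) : int :=
  if (p %| a)%Z then 0%R
  else if [exists x : 'I_p, ((Posz x ^+ 2)%R == a %[mod p])%Z] then 1%R
  else (-1)%R.

(* Main.v *)
Require Import Defs.
From mathcomp Require Import all_boot all_order all_algebra.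
From mathcomp Require Import qpoly cyclic finfield.
From mathcomp Require Import zify ring lra.
Set Implicit Arguments.
Unset Strict Implicit.
Unset Printing Implicit Defensive.
Import Order.TTheory GRing.Theory Num.Theory.
Local Open Scope ring_scope.

(** The entries being odd, a sequence of odd weight has an even number of
    entries besides its peak; hence the cross terms of
    [prod (1 + q^(2i+1))^2] do not contribute modulo 4, and [ou*(2K+1)] is
    congruent to the coefficient of [x^K] in
    [S(x) = sum_m x^m prod_(i < m) (1 + x^(2i+1))], which is the third order mock theta function [nu(-x)].  By a bilateral
    (1psi1) summation its even part is a theta quotient: with
    [J_k = prod_i (1 - y^(k i))] and [y = x^2],
    [S(x) + S(-x) = 2 J_2^3 / J_1^2].  As [J_1^4 = J_2^2] modulo 4, this is
    [2 J_1^2 J_2 = 2 phi(-y) phi(-y^2) J_4] modulo 8.  Jacobi's triple product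
    then gives, for [K = 2L] and [M = 6L + 1] not a square, that [ou*(4L+1)] is
    modulo 4 twice the number of positive solutions of [M = x^2 + 6 y^2] or
    [M = x^2 + 12 y^2].

    In the theorem [M = l k] with [l] not dividing [k].  If [l = c1 u^2 + c2 v^2],
    [c1 c2 = D], then multiplying by [(u sqrt c1 + v sqrt (- c2))^2 / l] and
    conjugating is an involution of the solutions of [M = x^2 + D y^2]; it has
    a fixed point only if [c1 = 1] and [k] is a square, and then exactly one.
    So both counts are even unless [k] is a square; if [k] is a square
    then [l = M] modulo 24, both counts are odd for [l = 1] and both vanish for
    [l = 19] modulo 24, while [l = 7, 13] is excluded by the hypothesis on the
    Legendre symbol.

    Power series in [x] are replaced throughout by elements of a commutative
    ring in which [x ^+ N = 0]. *)

(** * Truncated q-series *)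

Section QPochhammer.
Variable A : comNzRingType.
Implicit Types p z : A.

(* The Pochhammer symbol [(-z; p)_n], with the sign of [z] reversed. *)
Definition qpoch z p n : A := \prod_(i < n) (1 + z * p ^+ i).

Lemma qpochS z p n : qpoch z p n.+1 = qpoch z p n * (1 + z * p ^+ n).
Proof. by rewrite /qpoch big_ord_recr. Qed.

Lemma qpochSl z p n : qpoch z p n.+1 = (1 + z) * qpoch (z * p) p n.
Proof.
rewrite /qpoch big_ord_recl expr0 mulr1; congr (_ * _).
by apply: eq_bigr => i _; rewrite lift0 exprS mulrA.
Qed.

End QPochhammer.

Section Nilpotent.
Variables (A : comNzRingType) (N : nat) (p : A).
Hypothesis pN0 : p ^+ N = 0.

Lemma nilp_exp n : (N <= n)%N -> p ^+ n = 0.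
Proof. by move=> /subnK <-; rewrite exprD pN0 mulr0. Qed.

(** Factors of index at least [N] equal 1, so [qpoch z p N] plays the part of the infinite
    product. *)
Lemma qpoch_stable z n : (N <= n)%N -> qpoch z p n = qpoch z p N.
Proof.
move=> /subnK <-; elim: (n - N)%N => // m IHm.
by rewrite addSn qpochS IHm nilp_exp ?leq_addl // mulr0 addr0 mulr1.
Qed.

Lemma qpoch_shift z : qpoch z p N = (1 + z) * qpoch (z * p) p N.
Proof. by rewrite -qpochSl qpoch_stable ?leqnSn. Qed.

Definition geom_sum n : A := \sum_(k < N) (p ^+ n) ^+ k.

(* [1 / (p; p)_n], where [1 / (1 - p^(i+1))] is the geometric sum: [p ^+ N = 0]. *)
Definition inv_qfact n : A := \prod_(i < n) geom_sum i.+1.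

Lemma geom_sumP n : (1 - p ^+ n.+1) * geom_sum n.+1 = 1.
Proof.
have := subrX1 (p ^+ n.+1) N; rewrite -exprM (nilp_exp (leq_pmull N (ltn0Sn n))) => E.
by rewrite /geom_sum -(opprB (p ^+ _)) mulNr -E sub0r opprK.
Qed.

Lemma inv_qfact0 : inv_qfact 0 = 1. Proof. exact: big_ord0. Qed.

Lemma inv_qfactS n : (1 - p ^+ n.+1) * inv_qfact n.+1 = inv_qfact n.
Proof. by rewrite /inv_qfact big_ord_recr /= mulrCA geom_sumP mulr1. Qed.

Lemma inv_qfactK n : qpoch (- p) p n * inv_qfact n = 1.
Proof.
elim: n => [|n IHn]; first by rewrite inv_qfact0 mulr1 /qpoch big_ord0.
by rewrite qpochS mulNr -exprS -mulrA inv_qfactS.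
Qed.

Lemma inv_qfact_stable n : (N <= n)%N -> inv_qfact n = inv_qfact N.
Proof.
move=> leNn; rewrite -[LHS]mulr1 -(inv_qfactK N) -(qpoch_stable _ leNn) mulrA.
by rewrite [inv_qfact n * _]mulrC inv_qfactK mul1r.
Qed.

(** Euler's expansion of the infinite product: [f y = (1 + y) * f (y * p)], and [N] iterations bring
    the argument to 0. The bound [N < B] kills the top term of [f (y * p)]. *)
Lemma euler_sum z B : (N < B)%N ->
  \sum_(j < B) z ^+ j * p ^+ 'C(j, 2) * inv_qfact j = qpoch z p N.
Proof.
case: B => // B; rewrite ltnS => leNB.
pose f z := \sum_(j < B.+1) z ^+ j * p ^+ 'C(j, 2) * inv_qfact j.
rewrite -/(f z).
have fS y : f y = (1 + y) * f (y * p).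
  rewrite mulrDl mul1r /f [in X in _ + y * X]big_ord_recr /=.
  rewrite exprMn (nilp_exp leNB) mulr0 !mul0r addr0.
  apply/eqP; rewrite addrC -subr_eq -sumrB big_ord_recl /= !expr0 subrr add0r.
  rewrite mulr_sumr; apply/eqP/eq_bigr => i _; rewrite /bump add1n binS bin1.
  by rewrite -(inv_qfactS i) !exprMn exprD !exprS; ring.
have fn n : f z = qpoch z p n * f (z * p ^+ n).
  elim: n => [|n IHn]; first by rewrite /qpoch big_ord0 mul1r mulr1.
  by rewrite IHn fS qpochS exprSr !mulrA.
rewrite (fn N) pN0 mulr0 /f big_ord_recl big1 => [|i _].
  by rewrite /= inv_qfact0 !mulr1 addr0 mulr1.
by rewrite lift0 exprS !mul0r.
Qed.

(** Euler's companion expansion of the reciprocal product, obtained by iterating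
    [(1 - z) f(z) = f(z p)]. *)
Lemma euler_sum_inv z B : z ^+ B = 0 ->
  (\sum_(j < B) z ^+ j * inv_qfact j) * qpoch (- z) p N = 1.
Proof.
move=> zB0; pose f n := \sum_(j < B) (z * p ^+ n) ^+ j * inv_qfact j.
have zpB0 n : (z * p ^+ n) ^+ B = 0 by rewrite exprMn zB0 mul0r.
have fS n : (1 - z * p ^+ n) * f n = f n.+1.
  rewrite mulrBl mul1r; apply/eqP; rewrite subr_eq addrC -subr_eq -sumrB.
  rewrite {}/f exprSr mulrA; move: (z * p ^+ n) (zpB0 n) => x.
  case: B {zB0 zpB0} => [|B] xB0; first by rewrite !big_ord0 mulr0.
  rewrite big_ord_recl big_ord_recr /= !expr0 subrr add0r mulrDr mulrA -exprS.
  rewrite xB0 mul0r addr0 mulr_sumr; apply/eqP/eq_bigr => i _.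
  by rewrite /bump add1n -(inv_qfactS i) !exprMn !exprS; ring.
have fn n : f 0 * qpoch (- z) p n = f n.
  elim: n => [|n IHn]; first by rewrite /qpoch big_ord0 mulr1.
  by rewrite qpochS mulrA IHn mulNr mulrC fS.
have := fn N; rewrite /f expr0 mulr1 => ->; rewrite pN0 mulr0.
case: B {f zpB0 fS fn} zB0 => [/eqP|B _]; first by rewrite expr0 oner_eq0.
rewrite big_ord_recl big1 => [|i _]; first by rewrite /= inv_qfact0 mulr1 addr0.
by rewrite lift0 exprS !mul0r.
Qed.

End Nilpotent.

(** * Jacobi's triple product *)

Section JacobiTriple.
Variables (A : comNzRingType) (N : nat) (p : A).
Hypothesis pN0 : p ^+ N = 0.
Local Notation e := (inv_qfact N p).

(* The Gaussian binomial coefficient [2n, n + k] in base [p]. *)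
Definition central_qbinom n k : A :=
  if (k <= n)%N then qpoch (- p) p n.*2 * e (n - k) * e (n + k) else 0.

Lemma central_qbinom_gt n k : (n < k)%N -> central_qbinom n k = 0.
Proof. by rewrite /central_qbinom ltnNge => /negbTE->. Qed.

Lemma central_qbinomnn n : central_qbinom n n = 1.
Proof. by rewrite /central_qbinom leqnn subnn inv_qfact0 addnn mulr1 inv_qfactK. Qed.

(** For the middle coefficient the two neighbours agree by symmetry, whence the factor 2. *)
Lemma central_qbinomS0 n :
  central_qbinom n.+1 0 = (1 + p ^+ n.*2.+1) * central_qbinom n 0 + 2 * p ^+ n.+1 * central_qbinom n 1.
Proof.
have ->: central_qbinom n 1 = qpoch (- p) p n.*2 * ((1 - p ^+ n) * e n) * e n.+1.
  rewrite /central_qbinom addn1; case: n => [|n]; first by rewrite subrr mul0r mulr0 mul0r.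
  by rewrite (inv_qfactS pN0) subn1.
rewrite /central_qbinom !leq0n !subn0 !addn0 doubleS !qpochS -(inv_qfactS pN0 n).
by rewrite -addnn !exprS !exprD; ring.
Qed.

(** Two q-Pascal steps at once; the weights come from expanding [(1 + u p^n)(1 + v p^n)] with
    [u v = p]. *)
Lemma central_qbinomS n k : (k <= n)%N ->
  central_qbinom n.+1 k.+1 = (1 + p ^+ n.*2.+1) * central_qbinom n k.+1
    + p ^+ (n - k) * central_qbinom n k + p ^+ (n + k).+2 * central_qbinom n k.+2.
Proof.
rewrite leq_eqVlt => /predU1P[->|ltkn].
  by rewrite !central_qbinomnn subnn !central_qbinom_gt ?ltnS // !mulr0 addr0 add0r mulr1.
have [d def_n]: exists d, n = (k + d).+1.
  by exists (n - k.+1)%N; rewrite -addSn subnKC.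
have ->: central_qbinom n k.+2 =
    qpoch (- p) p n.*2 * ((1 - p ^+ d) * e d) * e (n + k.+2).
  rewrite /central_qbinom def_n; case: d {def_n} => [|d].
    by rewrite addn0 ltnn subrr mul0r mulr0 mul0r.
  rewrite (inv_qfactS pN0) addnS !ltnS leq_addr; congr (_ * e _ * _); lia.
rewrite /central_qbinom leqW ?ltnS // ltkn ltnW // doubleS !qpochS.
have -> : (n.+1 - k.+1 = d.+1)%N by lia.
have -> : (n - k.+1 = d)%N by lia.
have -> : (n - k = d.+1)%N by lia.
have -> : (n.+1 + k.+1 = (n + k).+2)%N by lia.
have -> : (n + k.+2 = (n + k).+2)%N by lia.
have -> : (n + k.+1 = (n + k).+1)%N by lia.
rewrite -(inv_qfactS pN0 (n + k)) -(inv_qfactS pN0 (n + k).+1) -(inv_qfactS pN0 d).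
have -> : n.*2 = (d + (n + k).+1)%N by lia.
by rewrite !exprS !exprD !exprS !exprD; ring.
Qed.


(** Induction on [n]. Here [v] stands for [p / u], and pairing [u^k] with [v^k] avoids negative
    powers. Multiplying a pair by [u + v] shifts its index both ways, which is [s_rec]. *)
Lemma jacobi_triple_finite u v n : u * v = p ->
  qpoch u p n * qpoch v p n = central_qbinom n 0
    + \sum_(k < n) central_qbinom n k.+1 * ((u ^+ k.+1 + v ^+ k.+1) * p ^+ 'C(k.+1, 2)).
Proof.
move=> uv_p; pose s k := (u ^+ k + v ^+ k) * p ^+ 'C(k, 2).
have s_rec k m : p ^+ (m + k.+1) * (u + v) * s k.+1 =
    p ^+ m * s k.+2 + p ^+ (m + k.+1).+1 * p ^+ k * s k.
  rewrite /s !binS !bin1 !bin0 !addn1 !(exprS, exprD).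
  set X := p ^+ m; set Y := p ^+ k; set Z := p ^+ _.
  apply/eqP; rewrite -subr_eq0; apply/eqP.
  transitivity (X * Y * Y * Z * p * (u ^+ k + v ^+ k) * (u * v - p)); first by ring.
  by rewrite uv_p subrr mulr0.
rewrite -[RHS]/(central_qbinom n 0 + \sum_(k < n) central_qbinom n k.+1 * s k.+1).
elim: n => [|n IHn]; first by rewrite /qpoch !big_ord0 central_qbinomnn mulr1 addr0.
rewrite !qpochS mulrACA {}IHn.
have -> : (1 + u * p ^+ n) * (1 + v * p ^+ n)
    = 1 + p ^+ n.*2.+1 + p ^+ n * (u + v).
  by rewrite -addnn exprS exprD -uv_p; ring.
rewrite mulrDr [_ * (p ^+ n * _)]mulrDl.
have cs_rec k : (k < n)%N -> central_qbinom n k.+1 * s k.+1 * (p ^+ n * (u + v)) =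
    p ^+ (n - k.+1) * central_qbinom n k.+1 * s k.+2
    + p ^+ (n + k.+1) * central_qbinom n k.+1 * s k.
  move=> ltkn; rewrite -mulrA [s _ * _]mulrC.
  have := s_rec k (n - k.+1)%N; rewrite subnK // => ->.
  by rewrite -exprD addSnnS; ring.
have -> : (\sum_(k < n) central_qbinom n k.+1 * s k.+1) * (p ^+ n * (u + v)) =
    \sum_(k < n) p ^+ (n - k.+1) * central_qbinom n k.+1 * s k.+2 +
    \sum_(k < n) p ^+ (n + k.+1) * central_qbinom n k.+1 * s k.
  by rewrite mulr_suml -big_split; apply: eq_bigr => k _; rewrite cs_rec.
have -> : central_qbinom n.+1 0 + \sum_(k < n.+1) central_qbinom n.+1 k.+1 * s k.+1 =
    (1 + p ^+ n.*2.+1) * (central_qbinom n 0 + \sum_(k < n.+1) central_qbinom n k.+1 * s k.+1)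
    + \sum_(k < n.+1) p ^+ (n - k) * central_qbinom n k * s k.+1
    + (2 * p ^+ n.+1 * central_qbinom n 1
      + \sum_(k < n.+1) p ^+ (n + k).+2 * central_qbinom n k.+2 * s k.+1).
  rewrite central_qbinomS0 mulrDr mulr_sumr.
  have -> : \sum_(k < n.+1) central_qbinom n.+1 k.+1 * s k.+1 =
      \sum_(k < n.+1) (1 + p ^+ n.*2.+1) * (central_qbinom n k.+1 * s k.+1)
      + \sum_(k < n.+1) p ^+ (n - k) * central_qbinom n k * s k.+1
      + \sum_(k < n.+1) p ^+ (n + k).+2 * central_qbinom n k.+2 * s k.+1.
    rewrite -!big_split; apply: eq_bigr => k _ /=.
    by rewrite central_qbinomS -1?ltnS //; ring.
  by ring.
rewrite [\sum_(k < n.+1) central_qbinom n k.+1 * s k.+1]big_ord_recr /= (central_qbinom_gt (ltnSn n)) mul0r addr0.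
rewrite [\sum_(k < n.+1) p ^+ (n - k) * central_qbinom n k * s k.+1]big_ord_recl /= subn0.
rewrite [\sum_(k < n.+1) p ^+ (n + k).+2 * central_qbinom n k.+2 * s k.+1]big_ord_recr /=.
rewrite (central_qbinom_gt (leqnSn n.+1)) mulr0 mul0r addr0.
have -> : 2 * p ^+ n.+1 * central_qbinom n 1 +
    \sum_(k < n) p ^+ (n + k).+2 * central_qbinom n k.+2 * s k.+1 =
    \sum_(k < n) p ^+ (n + k.+1) * central_qbinom n k.+1 * s k.
  (* As [s 0 = 2], this is the missing term of index 0. *)
  have -> : 2 * p ^+ n.+1 * central_qbinom n 1 = p ^+ (n + 1) * central_qbinom n 1 * s 0.
    by rewrite /s addn1 !expr0; ring.
  transitivity (\sum_(k < n.+1) p ^+ (n + k.+1) * central_qbinom n k.+1 * s k).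
    rewrite big_ord_recl; congr (_ + _); apply: eq_bigr => k _.
    by rewrite lift0 !addnS.
  by rewrite big_ord_recr /= (central_qbinom_gt (ltnSn n)) mulr0 mul0r addr0.
have -> : s 1 = u + v by rewrite /s !expr1 mulr1.
by rewrite /bump; ring.
Qed.

Lemma jacobi_triple u v B : u * v = p -> (N <= B)%N ->
  qpoch (- p) p N * qpoch u p N * qpoch v p N =
    1 + \sum_(k < B) (u ^+ k.+1 + v ^+ k.+1) * p ^+ 'C(k.+1, 2).
Proof.
move=> uv_p leNB.
pose s k := (u ^+ k.+1 + v ^+ k.+1) * p ^+ 'C(k.+1, 2).
rewrite -[RHS]/(1 + \sum_(k < B) s k).
have s0 k : (N <= k)%N -> s k = 0.
  move=> leNk; rewrite /s (nilp_exp pN0) ?mulr0 //.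
  by rewrite (leq_trans leNk) // binS bin1 leq_addl.
(* At level [2N], both [2N - k] and [2N + k] are at least [N], so every symbol in [central_qbinom]
   has its stable value. *)
have c1 k : (k <= N)%N -> qpoch (- p) p N * central_qbinom N.*2 k = 1.
  move=> lekN; have [le1 [le2 le3]] : (k <= N.*2 /\ N <= N.*2 - k /\ N <= N.*2)%N.
    by lia.
  rewrite /central_qbinom le1 (inv_qfact_stable pN0 le2).
  rewrite (inv_qfact_stable pN0 (leq_trans le3 (leq_addr k _))).
  have /(qpoch_stable pN0 (- p)) -> : (N <= N.*2.*2)%N by lia.
  by rewrite mulrA (inv_qfactK pN0) mulr1 inv_qfactK.
rewrite -mulrA -!(qpoch_stable pN0 _ (leq_addr N N)) addnn.
rewrite [qpoch (- p) p _](qpoch_stable pN0); last by lia.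
rewrite jacobi_triple_finite // -/(s _) mulrDr c1 // mulr_sumr; congr (_ + _).
rewrite -(subnKC leNB) -addnn !big_split_ord /=.
rewrite [X in _ + X = _]big1 ?addr0 => [|k _]; last first.
  by rewrite -/(s _) s0 ?mulr0 ?leq_addr.
rewrite [X in _ = _ + X]big1 ?addr0 => [|k _]; last by rewrite s0 ?leq_addr.
by apply: eq_bigr => k _; rewrite mulrA addnn c1 ?mul1r.
Qed.

End JacobiTriple.

(** * The mock theta function nu and its even part *)

Lemma bin2_double_add n : ('C(n, 2).*2 + n = n ^ 2)%N.
Proof. by elim: n => // n IHn; rewrite binS bin1; lia. Qed.

(* The third order mock theta function [nu] at [-x]. *)
Definition nu_trunc (A : comNzRingType) N (x : A) : A :=
  \sum_(m < N) x ^+ m * qpoch x (x ^+ 2) m.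

Section MockThetaNu.
Variables (A : comNzRingType) (N : nat) (x : A).
Hypothesis xN0 : x ^+ N = 0.
Local Notation p := (x ^+ 2).
Local Notation e := (inv_qfact N p).
Local Notation B := (N.*2.+1).

Lemma sqr_nilp : p ^+ N = 0.
Proof. by rewrite -exprM mulnC exprM xN0 expr0n. Qed.
Local Notation pN0 := sqr_nilp.

(** The infinite product [(x^(2k+1); x^2)]. *)
Let H k : A := qpoch (- x ^+ k.*2.+1) p N.

(** Iterating [W_rec] leads to the Eulerian form of nu, with general term
    [x^(n^2+n) / (x; x^2)_(n+1)]; the remainder after [N] steps carries [x^(N^2+N) = 0]. *)
Lemma nu_neg_part :
  H 0 * nu_trunc N x = \sum_(n < N) x ^+ (n ^ 2 + n) * H n.+1.
Proof.
pose W k := \sum_(m < N) x ^+ (k.*2.+1 * m) * qpoch x p m.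
have W_rec k : (1 - x ^+ k.*2.+1) * W k = 1 + x ^+ k.+1.*2 * W k.+1.
  have E : \sum_(m < N.+1) x ^+ (k.*2.+1 * m) * qpoch x p m = W k.
    by rewrite big_ord_recr /= (nilp_exp xN0 (leq_pmull N (ltn0Sn k.*2))) mul0r addr0.
  rewrite mulrBl mul1r -{1}E big_ord_recl muln0 expr0 mul1r -addrA.
  congr (_ + _); first by rewrite /qpoch big_ord0.
  rewrite !mulr_sumr -sumrB; apply: eq_bigr => i _.
  have -> : (k.+1.*2.+1 * i = k.*2.+1 * i + 2 * i)%N by lia.
  have -> : (k.+1.*2 = k.*2.+1 + 1)%N by lia.
  rewrite lift0 qpochS mulnS -exprM; move: (k.*2.+1) (2 * i)%N => c d.
  by rewrite !(exprD _ (c * i)) !(exprD _ c) expr1; ring.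
have H_rec k : H k = (1 - x ^+ k.*2.+1) * H k.+1.
  by rewrite /H (qpoch_shift pN0) mulNr -exprD !addnS addn0.
have HW n : H 0 * W 0 =
    \sum_(k < n) x ^+ (k ^ 2 + k) * H k.+1 + x ^+ (n ^ 2 + n) * (H n * W n).
  elim: n => [|n ->]; first by rewrite big_ord0 add0r mul1r.
  rewrite big_ord_recr /= -addrA; congr (_ + _).
  have -> : x ^+ (n.+1 ^ 2 + n.+1) = x ^+ (n ^ 2 + n) * x ^+ n.+1.*2.
    by rewrite -exprD; congr (_ ^+ _); lia.
  have -> : H n * W n = H n.+1 * (1 + x ^+ n.+1.*2 * W n.+1).
    by rewrite H_rec -W_rec; ring.
  by ring.
transitivity (H 0 * W 0).
  by congr (_ * _); apply: eq_bigr => i _; rewrite mul1n.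
by rewrite (HW N) [X in _ + X * _](nilp_exp xN0) ?leq_addl // mul0r addr0.
Qed.

Let dist m n : nat := ((m - n) + (n - m))%N.
(* The bilateral double series of general term
   [(-1)^m x^(s + (s - m)^2) / (x^2; x^2)_m] is evaluated twice: summing over
   [m] first gives [G s] for [s >= 0] and [shifted_sum], up to a power of [x],
   for [s < 0]; summing over [s] first gives a theta series ([theta_window]). *)
Let G s : A := \sum_(m < B) (-1) ^+ m * e m * x ^+ (dist s m ^ 2).

(** Euler's expansion at [z = - x^(2n+1)] in base [x^2]. *)
Lemma shifted_sum n :
  \sum_(m < B) (-1) ^+ m * e m * x ^+ (2 * n * m + m ^ 2) = H n.
Proof.
rewrite /H -(euler_sum pN0 _ (B := B)); last by lia.
apply: eq_bigr => m _; rewrite [(- x ^+ _) ^+ _]exprNn -!exprM.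
have -> : (2 * n * m + m ^ 2 = n.*2.+1 * m + 2 * 'C(m, 2))%N.
  by have := bin2_double_add m; rewrite -mul2n; lia.
by rewrite exprD; ring.
Qed.

(** As [2s + 1 + (s - m)^2 = 2m + (s + 1 - m)^2], the difference [G s.+1 - x^(2s+1) * G s] acquires
    the weight [1 - p^m], which lowers the index of [e m] and leaves [- G s]. The last term,
    [m = 2N], vanishes because [s < N]. *)
Lemma G_eval s : (s < N)%N -> G s = (-1) ^+ s * qpoch (- x) p s * H 0.
Proof.
elim: s => [|s IHs] ltsN.
  rewrite /qpoch big_ord0 !mul1r.
  rewrite -(shifted_sum 0); apply: eq_bigr => m _.
  by rewrite /dist sub0n subn0 muln0 mul0n.
have IH := IHs (ltnW ltsN).
rewrite qpochS -exprM [_ ^+ s.+1]exprS.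
have -> : -1 * (-1) ^+ s * (qpoch (- x) p s * (1 + - x * x ^+ (2 * s))) * H 0
    = (x ^+ (2 * s).+1 - 1) * G s.
  by rewrite IH [x ^+ (2 * s).+1]exprS; ring.
rewrite mulrBl mul1r; apply/eqP; rewrite addrC -subr_eq.
have -> : G s.+1 - x ^+ (2 * s).+1 * G s =
    \sum_(m < B) (-1) ^+ m * (e m * (1 - p ^+ m)) * x ^+ (dist s.+1 m ^ 2).
  rewrite mulr_sumr -sumrB; apply: eq_bigr => m _.
  have E : ((2 * s).+1 + dist s m ^ 2 = 2 * m + dist s.+1 m ^ 2)%N.
    rewrite /dist; case: (leqP m s) => ?; first by nia.
    by nia.
  rewrite -[p ^+ m]exprM; set c := (-1) ^+ m.
  transitivity (c * e m * x ^+ (dist s.+1 m ^ 2)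
                - c * e m * x ^+ ((2 * s).+1 + dist s m ^ 2)).
    by rewrite [x ^+ (_ + _)]exprD; ring.
  by rewrite E [x ^+ (_ + _)]exprD; ring.
rewrite big_ord_recl expr0 subrr mulr0 mulr0 mul0r add0r.
rewrite /G big_ord_recr /= [in X in _ * X](nilp_exp xN0) ?mulr0 ?addr0; last first.
  by rewrite /dist; nia.
rewrite -sumrN; apply/eqP/eq_bigr => m _; rewrite /bump add1n.
by rewrite [e m.+1 * _]mulrC (inv_qfactS pN0) exprS /dist !subSS; ring.
Qed.

(** The sums run over [s >= 0] and over [s = - n - 1]. With [t = s - m] the exponent is
    [m + t^2 + t], so together they form a bilateral theta series, folded in two by
    [t -> - 1 - t]. *)
Lemma theta_window m :
  \sum_(s < N) x ^+ (s + dist s m ^ 2)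
    + \sum_(n < N) x ^+ (n ^ 2 + n + (2 * n.+1 * m + m ^ 2)) =
  x ^+ m * (2 * \sum_(k < N) x ^+ (k ^ 2 + k)).
Proof.
pose F n := x ^+ m * \sum_(k < n) x ^+ (k ^ 2 + k).
have Fstable n : (N - m <= n)%N -> F n = F (N - m)%N.
  move=> /subnK <-; elim: (n - _)%N => // d IHd.
  rewrite addSn /F big_ord_recr /= mulrDr -exprD [x ^+ (m + _)](nilp_exp xN0).
    by rewrite addr0; exact: IHd.
  by nia.
have -> : x ^+ m * (2 * \sum_(k < N) x ^+ (k ^ 2 + k)) = F (N - m)%N + F (N - m)%N.
  by rewrite -(Fstable N) ?leq_subr // /F; ring.
case: (leqP N m) => [leNm|/ltnW lemN].
  rewrite !big1 ?addr0 => [|n _|s _]; last first.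
  - by rewrite (nilp_exp xN0) // /dist; have := ltn_ord s; nia.
  - by rewrite (nilp_exp xN0) //; nia.
  by rewrite (eqP leNm) /F big_ord0 mulr0 addr0.
have -> : \sum_(s < N) x ^+ (s + dist s m ^ 2) =
    \sum_(s < m) x ^+ (s + dist s m ^ 2) + F (N - m)%N.
  rewrite -!(big_mkord xpredT (fun s => x ^+ (s + dist s m ^ 2))).
  rewrite (@big_cat_nat _ _ _ m) //=; congr (_ + _).
  rewrite -{1}[m]add0n big_addn big_mkord.
  rewrite /F mulr_sumr; apply: eq_bigr => k _; rewrite -exprD /dist.
  by congr (_ ^+ _); nia.
rewrite addrAC; congr (_ + _).
rewrite -(Fstable (m + N)%N) ?leq_subLR /F ?big_split_ord ?mulrDr /=; last by lia.
rewrite !mulr_sumr (reindex_inj rev_ord_inj) /=; congr (_ + _);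
  apply: eq_bigr => k _; rewrite -exprD; congr (_ ^+ _); last by nia.
by rewrite /dist; have := ltn_ord k; nia.
Qed.

Lemma nu_even_part :
  qpoch x p N * qpoch (- x) p N * (nu_trunc N x + nu_trunc N (- x)) =
  2 * \sum_(k < N) x ^+ (k ^ 2 + k).
Proof.
have mxN0 : (- x) ^+ B = 0 by rewrite exprNn (nilp_exp xN0) ?mulr0 //; lia.
have H0E : H 0 = qpoch (- x) p N by rewrite /H expr1.
have total : H 0 * (nu_trunc N x + nu_trunc N (- x)) =
    (\sum_(m < B) (- x) ^+ m * e m) * (2 * \sum_(k < N) x ^+ (k ^ 2 + k)).
  rewrite mulrDr nu_neg_part addrC.
  have -> : H 0 * nu_trunc N (- x) = \sum_(s < N) x ^+ s * G s.
    rewrite mulr_sumr; apply: eq_bigr => s _.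
    by rewrite G_eval // sqrrN [(- x) ^+ s]exprNn; ring.
  have -> : \sum_(n < N) x ^+ (n ^ 2 + n) * H n.+1 =
      \sum_(m < B) (-1) ^+ m * e m *
        \sum_(n < N) x ^+ (n ^ 2 + n + (2 * n.+1 * m + m ^ 2)).
    under [RHS]eq_bigr do rewrite mulr_sumr.
    rewrite exchange_big /=; apply: eq_bigr => n _.
    rewrite -shifted_sum mulr_sumr; apply: eq_bigr => m _.
    by rewrite [x ^+ (_ + (_ * m + _))]exprD; ring.
  under eq_bigr do rewrite mulr_sumr.
  rewrite exchange_big -big_split mulr_suml; apply: eq_bigr => m _ /=.
  rewrite [(- x) ^+ m]exprNn -[_ * _ * e m]mulrAC -[RHS]mulrA -theta_window.
  rewrite mulrDr !mulr_sumr; congr (_ + _); apply: eq_bigr => s _.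
  by rewrite [x ^+ (s + _)]exprD; ring.
rewrite -mulrA -H0E total mulrA.
(* The remaining series in [m] is the reciprocal of [qpoch x p N]. *)
have := euler_sum_inv pN0 mxN0; rewrite opprK mulrC => ->.
by rewrite mul1r.
Qed.

End MockThetaNu.

(** * Theta functions as products *)

Definition euler_fun (A : comNzRingType) N (z : A) : A := qpoch (- z) z N.

(* Half of [phi(-z) - 1]. *)
Definition square_theta (A : comNzRingType) N (z : A) : A :=
  \sum_(k < N) (-1) ^+ k.+1 * z ^+ (k.+1 ^ 2).

(** With [m = k + 1] the exponents are [m(3m-1)/2] and [m(3m+1)/2], in the division-free shape given
    by the triple product. *)
Definition pentagonal_sum (A : comNzRingType) N (z : A) : A :=
  1 + \sum_(k < N) (-1) ^+ k.+1 *
        (z ^+ (k.+1 + 3 * 'C(k.+1, 2)) + z ^+ (k.+1.*2 + 3 * 'C(k.+1, 2))).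

Section ThetaProducts.
Variables (A : comNzRingType) (N : nat) (z : A).
Hypothesis zN0 : z ^+ N = 0.
Local Notation J := (euler_fun N).

Lemma exp_nilp n : (0 < n)%N -> (z ^+ n) ^+ N = 0.
Proof.
by case: n => // n _; rewrite -exprM mulnC exprM zN0 expr0n.
Qed.

Lemma euler_fun_sqr : qpoch z z N * J z = J (z ^+ 2).
Proof.
rewrite /euler_fun /qpoch -big_split; apply: eq_bigr => i _ /=.
by rewrite -exprM mulnC exprM; ring.
Qed.

Lemma euler_fun_odd : qpoch (- z) (z ^+ 2) N * J (z ^+ 2) = J z.
Proof.
rewrite /euler_fun -[RHS](qpoch_stable zN0 _ (leq_addr N N)) addnn.
elim: (N) => [|n IHn]; first by rewrite /qpoch !big_ord0 mulr1.
rewrite doubleS !qpochS mulrACA IHn -!exprM -mul2n.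
by rewrite [z ^+ (2 * n).+1]exprS; ring.
Qed.

(** Gauss's formula [phi(-z) = J(z)^2 / J(z^2)]: the triple product in base [z^2] at
    [u = v = - z]. *)
Lemma square_theta_product :
  (1 + 2 * square_theta N z) * J (z ^+ 2) = J z ^+ 2.
Proof.
have := jacobi_triple (exp_nilp (n := 2) isT) (u := - z) (v := - z).
move=> /(_ N); rewrite mulrNN -expr2 => /(_ erefl (leqnn N)).
rewrite -/(J (z ^+ 2)) => E.
have -> : 1 + 2 * square_theta N z =
    J (z ^+ 2) * qpoch (- z) (z ^+ 2) N * qpoch (- z) (z ^+ 2) N.
  rewrite E mulr_sumr; congr (_ + _); apply: eq_bigr => k _.
  rewrite [(- z) ^+ k.+1]exprNn -exprM.
  have -> : (k.+1 ^ 2 = 2 * 'C(k.+1, 2) + k.+1)%N.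
    by rewrite mul2n bin2_double_add.
  by rewrite [z ^+ (2 * 'C(k.+1, 2) + k.+1)]exprD; ring.
by rewrite -euler_fun_odd; ring.
Qed.

(** Triple product in base [z] at [u = z], [v = 1], where each triangular number occurs twice. The
    factor 2 stays, as it need not be cancellable in [A]. *)
Lemma triangular_theta_product :
  2 * (\sum_(k < N) z ^+ 'C(k.+1, 2)) * J z = 2 * J (z ^+ 2) ^+ 2.
Proof.
have := jacobi_triple zN0 (mulr1 z) (leqnn N).
rewrite -/(J z) (qpoch_shift zN0 1) mul1r => E.
have -> : 2 * (\sum_(k < N) z ^+ 'C(k.+1, 2)) =
    J z * qpoch z z N * ((1 + 1) * qpoch z z N).
  rewrite E; set s := \sum_(k < N) z ^+ _.
  have -> : \sum_(k < N) (z ^+ k.+1 + 1 ^+ k.+1) * z ^+ 'C(k.+1, 2) =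
      \sum_(k < N) z ^+ 'C(k.+2, 2) + s.
    rewrite -big_split; apply: eq_bigr => k _ /=.
    by rewrite [in RHS]binS bin1 exprD expr1n; ring.
  rewrite addrA; suff -> : 1 + \sum_(k < N) z ^+ 'C(k.+2, 2) = s by ring.
  transitivity (\sum_(k < N.+1) z ^+ 'C(k.+1, 2)).
    by rewrite big_ord_recl.
  rewrite big_ord_recr /= [z ^+ 'C(_, _)](nilp_exp zN0) ?addr0 //.
  by rewrite binS bin1 leq_addl.
by rewrite -euler_fun_sqr; ring.
Qed.

(** Triple product in base [z^3] at [u = - z], [v = - z^2]: the three products interleave to
    [J z]. *)
Lemma pentagonal_number_theorem : J z = pentagonal_sum N z.
Proof.
have uv : (- z) * (- z ^+ 2) = z ^+ 3 by ring.
have := jacobi_triple (exp_nilp (n := 3) isT) uv (leqnn N).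
have -> : qpoch (- z ^+ 3) (z ^+ 3) N * qpoch (- z) (z ^+ 3) N *
    qpoch (- z ^+ 2) (z ^+ 3) N = J z.
  rewrite /euler_fun -[RHS](qpoch_stable zN0 _ (leq_pmull N (ltn0Sn 2))).
  elim: (N) => [|n IHn]; first by rewrite /qpoch !big_ord0 !mulr1.
  have -> : (3 * n.+1 = (3 * n).+3)%N by lia.
  rewrite !qpochS -{}IHn -!exprM.
  by rewrite [z ^+ (3 * n).+2]exprS [z ^+ (3 * n).+1]exprS; ring.
move=> ->; congr (_ + _); apply: eq_bigr => k _.
rewrite [(- z) ^+ _]exprNn [(- z ^+ 2) ^+ _]exprNn -!exprM -mul2n.
by rewrite !(exprD z _ (3 * _)); ring.
Qed.

Lemma euler_fun_pow4_mod4 : exists r, J z ^+ 4 = J (z ^+ 2) ^+ 2 + 4 * r.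
Proof.
rewrite /euler_fun; elim: (N) => [|n [r E]].
  by exists 0; rewrite /qpoch !big_ord0; ring.
rewrite !qpochS !exprMn E.
move: (z ^+ n) => w; set Q := qpoch _ _ n.
(* With [y = z w], the new factor satisfies [(1 - y)^4 = (1 - y^2)^2 - 4 y (1 - y)^2]. *)
exists (r * (1 + - z * w) ^+ 4 - Q ^+ 2 * z * w * (1 - z * w) ^+ 2); ring.
Qed.

End ThetaProducts.

Lemma nu_even_mod8 (A : comNzRingType) N (x : A) : x ^+ N = 0 ->
  exists r, nu_trunc N x + nu_trunc N (- x) =
    2 * pentagonal_sum N (x ^+ 8)
    + 4 * ((square_theta N (x ^+ 2) + square_theta N (x ^+ 4))
           * pentagonal_sum N (x ^+ 8)) + 8 * r.
Proof.
move=> xN0; set T := _ + _.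
have x2N0 := exp_nilp xN0 (n := 2) isT.
have x4N0 := exp_nilp xN0 (n := 4) isT.
have x8N0 := exp_nilp xN0 (n := 8) isT.
rewrite -(pentagonal_number_theorem x8N0).
set J1 := euler_fun N (x ^+ 2); set J2 := euler_fun N (x ^+ 4).
set J4 := euler_fun N (x ^+ 8).
set a1 := square_theta N (x ^+ 2); set a2 := square_theta N (x ^+ 4).
have phi1 : (1 + 2 * a1) * J2 = J1 ^+ 2.
  by have := square_theta_product x2N0; rewrite -exprM.
have phi2 : (1 + 2 * a2) * J4 = J2 ^+ 2.
  by have := square_theta_product x4N0; rewrite -exprM.
(* As [(x^2; x^4) = J1 / J2], [nu_even_part] reads [T J1 / J2 = 2 psi(x^2) = 2 J2^2 / J1], where
   [psi] is the triangular theta series. *)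
have T_J1 : J1 ^+ 2 * T = 2 * J2 ^+ 3.
  have psi := triangular_theta_product x2N0.
  have odd := euler_fun_odd x2N0.
  rewrite -exprM -/J1 -/J2 in psi odd.
  have nu := nu_even_part xN0; rewrite -/T in nu.
  have E : qpoch x (x ^+ 2) N * qpoch (- x) (x ^+ 2) N
      = qpoch (- x ^+ 2) (x ^+ 4) N.
    rewrite /qpoch -big_split; apply: eq_bigr => i _ /=.
    have -> : (x ^+ 4) ^+ i = (x ^+ 2) ^+ i * (x ^+ 2) ^+ i.
      by rewrite -!exprM -exprD; congr (_ ^+ _); lia.
    by ring.
  have E2 : \sum_(k < N) x ^+ (k ^ 2 + k) = \sum_(k < N) (x ^+ 2) ^+ 'C(k.+1, 2).
    apply: eq_bigr => k _; rewrite -exprM; congr (_ ^+ _).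
    by have := bin2_double_add k.+1; rewrite -mul2n; lia.
  rewrite E E2 in nu.
  transitivity (qpoch (- x ^+ 2) (x ^+ 4) N * T * J1 * J2).
    by rewrite -odd; ring.
  by rewrite nu psi; ring.
have [r E4] := euler_fun_pow4_mod4 N (x ^+ 2); rewrite -exprM -/J1 -/J2 in E4.
have [I JI] : exists I, J1 * I = 1 by exists (inv_qfact N (x ^+ 2) N); apply: inv_qfactK.
(* From [T = 2 I^2 J2^3] and [J2^2 = J1^4 - 4 r], the two Gauss formulas give [T = 2 (1 + 2 a1) (1 +
   2 a2) J4 - 8 I^2 J2 r]. *)
exists (a1 * a2 * J4 - I ^+ 2 * J2 * r).
transitivity ((J1 * I) ^+ 2 * T); first by rewrite JI expr1n mul1r.
transitivity (I ^+ 2 * (J1 ^+ 2 * T)); first by ring.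
rewrite T_J1.
transitivity (2 * I ^+ 2 * J2 * (J2 ^+ 2 + 4 * r) - 8 * I ^+ 2 * J2 * r); first by ring.
rewrite -E4.
transitivity (2 * (J1 * I) ^+ 2 * J1 ^+ 2 * J2 - 8 * I ^+ 2 * J2 * r); first by ring.
rewrite JI -phi1.
transitivity (2 * (1 + 2 * a1) * J2 ^+ 2 - 8 * I ^+ 2 * J2 * r); first by ring.
by rewrite -phi2; ring.
Qed.

(** * Coefficient extraction *)

Definition nreps (D M : nat) : nat :=
  \sum_(x < M.+1) \sum_(y < M.+1) [&& 0 < x, 0 < y & x ^ 2 + D * y ^ 2 == M]%N.

Section Morphisms.
Variables (A A' : comNzRingType) (f : {rmorphism A -> A'}).

Lemma rmorph_qpoch z p n : f (qpoch z p n) = qpoch (f z) (f p) n.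
Proof.
rewrite rmorph_prod; apply: eq_bigr => i _.
by rewrite rmorphD rmorph1 rmorphM rmorphXn.
Qed.

Lemma rmorph_nu_trunc N x : f (nu_trunc N x) = nu_trunc N (f x).
Proof.
rewrite rmorph_sum; apply: eq_bigr => i _.
by rewrite rmorphM rmorph_qpoch !rmorphXn.
Qed.

Lemma rmorph_square_theta N x : f (square_theta N x) = square_theta N (f x).
Proof.
rewrite rmorph_sum; apply: eq_bigr => i _.
by rewrite rmorphM !rmorphXn rmorphN rmorph1.
Qed.

Lemma rmorph_pentagonal_sum N x : f (pentagonal_sum N x) = pentagonal_sum N (f x).
Proof.
rewrite rmorphD rmorph1 rmorph_sum; congr (_ + _); apply: eq_bigr => i _.
by rewrite rmorphM rmorphD !rmorphXn rmorphN rmorph1.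
Qed.

End Morphisms.

Lemma in_qpoly_Xn_coef (R : comNzRingType) N (p q : {poly R}) i : (i < N)%N ->
  in_qpoly 'X^N p = in_qpoly 'X^N q -> p`_i = q`_i.
Proof.
case: N => // N ltiN E.
have mE : mk_monic 'X^(N.+1) = 'X^(N.+1) :> {poly R} by rewrite mk_monic_Xn.
have coef_mod (r : {poly R}) : r`_i = (in_qpoly 'X^(N.+1) r : {poly R})`_i.
  rewrite /= mE {1}(Pdiv.RingMonic.rdivp_eq (monicXn R N.+1) r).
  by rewrite coefD coefMXn ltiN add0r.
by rewrite (coef_mod p) E -coef_mod.
Qed.

Lemma coef_comp_polyNX (R : comNzRingType) (p : {poly R}) i :
  (p \Po - 'X)`_i = (-1) ^+ i * p`_i.
Proof.
have -> : - 'X = (-1 : R) *: 'X by rewrite scaleN1r.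
elim/poly_ind: p i => [|p c IHp] i; first by rewrite comp_poly0 !coef0 mulr0.
rewrite comp_polyD comp_polyM comp_polyX comp_polyC -scalerAr !coefD coefZ !coefMX.
rewrite !coefC; case: i => [|i] /=; first by rewrite mulr0 !add0r mul1r.
by rewrite !addr0 IHp exprS mulrA.
Qed.

Lemma nu_trunc_coef_mod4 N i : (i < N)%N -> ~~ odd i ->
  exists r : int, (nu_trunc N 'X)`_i = (pentagonal_sum N 'X^8)`_i
    + 2 * ((square_theta N 'X^2 + square_theta N 'X^4)
           * pentagonal_sum N 'X^8)`_i + 4 * r.
Proof.
move=> ltiN even_i; pose h : {poly int} := 'X^N.
pose f : {rmorphism {poly int} -> {poly %/ h}} := in_qpoly h.
have hE : mk_monic h = h.
  by rewrite mk_monic_Xn prednK //; apply: leq_ltn_trans ltiN.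
have fXN : f 'X ^+ N = 0.
  rewrite -rmorphXn; apply/val_inj; rewrite /= hE.
  exact: Pdiv.RingMonic.rmodpp (monicXn _ _).
have [r E] := nu_even_mod8 fXN.
have [r' Er] : exists r', f r' = r.
  by exists (val r); apply/val_inj; rewrite /= Pdiv.CommonRing.rmodp_small // size_mk_monic.
have nuN : nu_trunc N (- 'X) = nu_trunc N 'X \Po - 'X :> {poly int}.
  by rewrite (rmorph_nu_trunc (comp_poly (- 'X))) /= comp_polyX.
move: E; rewrite -Er -rmorphN -!rmorphXn -!(rmorph_nu_trunc f) nuN.
rewrite -!(rmorph_square_theta f) -(rmorph_pentagonal_sum f).
move: (nu_trunc N 'X) (square_theta N 'X^2) (square_theta N 'X^4) => S T1 T2.
move: (pentagonal_sum N 'X^8) => P E.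
have {E} : f (S + (S \Po - 'X)) = f (P *+ 2 + (T1 + T2) * P *+ 4 + r' *+ 8).
  by rewrite 3!rmorphD !rmorphMn rmorphM rmorphD E !mulr_natl.
move=> /(in_qpoly_Xn_coef ltiN).
move: ((T1 + T2) * P) => Q; rewrite !coefD coef_comp_polyNX -signr_odd (negbTE even_i) mul1r => E.
by exists r'`_i; move: E; move: S`_i P`_i Q`_i r'`_i => *; lia.
Qed.

Lemma coprime6E w : coprime w 6 = ((w %% 6 == 1) || (w %% 6 == 5))%N.
Proof.
rewrite -coprime_modl; have := ltn_pmod w (isT : 0 < 6)%N.
by case: (w %% 6)%N => [|[|[|[|[|[|[]]]]]]].
Qed.

(** A generalised pentagonal number is [(w^2 - 1) / 24] with [w = 6m - 1] or [w = 6m + 1]; indexing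
    by [w] makes exponents squares. In both cases [(w + 1) / 6] rounds down to [m], which gives the
    sign. *)
Lemma pentagonal_sum8E (A : comNzRingType) N (x : A) :
  pentagonal_sum N (x ^+ 8) = \sum_(w < 6 * N + 2 | coprime w 6)
    (-1) ^+ (w.+1 %/ 6) * x ^+ ((w ^ 2 - 1) %/ 3).
Proof.
pose F w : A := if coprime w 6 then
  (-1) ^+ (w.+1 %/ 6) * x ^+ ((w ^ 2 - 1) %/ 3) else 0.
rewrite big_mkcond -[RHS]/(\sum_(w < 6 * N + 2) F w) /pentagonal_sum.
elim: N => [|N IHN].
  rewrite muln0 add0n big_ord0 addr0 !big_ord_recr big_ord0 /F /= !add0r.
  by rewrite exp1n subnn div0n divn_small // !expr0 mul1r.
have -> : (6 * N.+1 + 2 = (6 * N + 2).+1.+1.+1.+1.+1.+1)%N by lia.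
rewrite 7!big_ord_recr /= -IHN addrA -!addrA.
congr (_ + (_ + _)).
rewrite /F !coprime6E.
have -> : ((6 * N + 2) %% 6 = 2)%N by lia.
have -> : ((6 * N + 2).+1 %% 6 = 3)%N by lia.
have -> : ((6 * N + 2).+2 %% 6 = 4)%N by lia.
have -> : ((6 * N + 2).+3 %% 6 = 5)%N by lia.
have -> : ((6 * N + 2).+4 %% 6 = 0)%N by lia.
have -> : ((6 * N + 2).+4.+1 %% 6 = 1)%N by lia.
rewrite /= !add0r -!exprM.
have C2 := bin2_double_add N.+1; rewrite -mul2n in C2.
have -> : ((6 * N + 2).+4 %/ 6 = N.+1)%N by lia.
have -> : ((6 * N + 2).+4.+2 %/ 6 = N.+1)%N by lia.
have -> : (((6 * N + 2).+3 ^ 2 - 1) %/ 3 = 8 * (N.+1 + 3 * 'C(N.+1, 2)))%N by lia.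
have -> : (((6 * N + 2).+4.+1 ^ 2 - 1) %/ 3
    = 8 * (N.+1.*2 + 3 * 'C(N.+1, 2)))%N by lia.
by rewrite mulrDr.
Qed.

Lemma coef_pentagonal_nonsquare N i : (forall m, m ^ 2 <> 3 * i + 1)%N ->
  (pentagonal_sum N ('X^8 : {poly int}))`_i = 0.
Proof.
move=> nsq; rewrite pentagonal_sum8E coef_sum big1 // => w cop_w.
rewrite -signr_odd mulr_sign; set b := odd _.
suff E : ('X^((w ^ 2 - 1) %/ 3) : {poly int})`_i = 0.
  by case: b; rewrite ?coefN E ?oppr0.
rewrite coefXn; case: eqP => // def_i; case: (nsq w).
by move: cop_w; rewrite coprime6E; nia.
Qed.

(** Multiplied by 3, the exponent condition becomes [w^2 + 3 d (k+1)^2 = M]. Since [d] is even and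
    [M] is 1 modulo 6, it already forces [w] to be coprime to 6. *)
Lemma nreps_theta d L M : (0 < d)%N -> ~~ odd d -> M = (6 * L + 1)%N ->
  nreps (3 * d) M = (\sum_(k < M.+1) \sum_(w < 6 * M.+1 + 2 | coprime w 6)
    (d * k.+1 ^ 2 + (w ^ 2 - 1) %/ 3 == 2 * L))%N.
Proof.
move=> d_gt0 even_d def_M.
pose F w k : nat := [&& 0 < w, 0 < k & w ^ 2 + 3 * d * k ^ 2 == M]%N.
transitivity (\sum_(w < 6 * M.+1 + 2) \sum_(k < M.+2) F w k)%N; last first.
  rewrite exchange_big /= big_ord_recl big1 ?add0n => [|w _]; last first.
    by rewrite /F /= andbF.
  apply: eq_bigr => k _; rewrite [RHS]big_mkcond /=; apply: eq_bigr => w _.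
  rewrite /F /bump /= add1n coprime6E; case: ifP => cop_w.
    congr (nat_of_bool _); apply/idP/idP; nia.
  apply/eqP; rewrite eqb0; apply/negP => /andP[_ /eqP E].
  have [X EX] : exists X, (3 * d * k.+1 ^ 2 = 6 * X)%N.
    by exists (d./2 * k.+1 ^ 2)%N; rewrite -{1}(even_halfK even_d) -mul2n; lia.
  have := divn_eq w 6; move: cop_w (ltn_pmod w (isT : 0 < 6)%N).
  move: (w %/ 6)%N (w %% 6)%N => q r ne_r lt_r def_w.
  have : (6 * (6 * q * q + 2 * q * r + X) + r * r = 6 * L + 1)%N.
    by rewrite -def_M -E EX def_w; lia.
  by case: r ne_r lt_r {def_w} => [|[|[|[|[|[|]]]]]] //; lia.
rewrite -[LHS]/(\sum_(w < M.+1) \sum_(k < M.+1) F w k)%N.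
rewrite (big_ord_widen (6 * M.+1 + 2) (fun w => \sum_(k < M.+1) F w k))%N; last by lia.
rewrite big_mkcond; apply: eq_bigr => w _; case: ltnP => [ltwM|leMw].
  have F0 : F w M.+1 = 0%N.
    by apply/eqP; rewrite eqb0; apply/negP => /and3P[_ _ /eqP]; nia.
  by rewrite [RHS]big_ord_recr /= F0 addn0.
rewrite big1 // => k _; apply/eqP; rewrite eqb0.
by apply/negP => /and3P[_ _ /eqP]; nia.
Qed.

(** Modulo 2 the signs of both series disappear, and the coefficient counts pairs of indices. *)
Lemma coef_theta_pentagonal d L M :
    (0 < d)%N -> ~~ odd d -> M = (6 * L + 1)%N ->
  exists r : int, (square_theta M.+1 'X^d * pentagonal_sum M.+1 'X^8)`_(2 * L)
    = (nreps (3 * d) M)%:Z + 2 * r.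
Proof.
move=> d_gt0 even_d def_M; rewrite (nreps_theta d_gt0 even_d def_M).
set c := _`_(2 * L); set n := (\sum_(k < _) _)%N.
suff : (2 %| c - n%:Z)%Z by case/dvdzP=> r def_c; exists r; lia.
rewrite {}/c {}/n pentagonal_sum8E mulr_suml coef_sum.
rewrite -natz natr_sum -sumrB rpred_sum // => k _.
rewrite mulr_sumr coef_sum natr_sum -sumrB rpred_sum // => w _.
set u := (_ %/ 6)%N; set v := (_ %/ 3)%N.
rewrite -exprM.
have -> : (-1) ^+ k.+1 * 'X^(d * k.+1 ^ 2) * ((-1) ^+ u * 'X^v) =
   (-1) ^+ (k.+1 + u) * 'X^(d * k.+1 ^ 2 + v) :> {poly int}.
  by rewrite !exprD; ring.
rewrite -signr_odd mulr_sign [_ == _]eq_sym.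
by case: ifP => _; rewrite ?coefN coefXn; case: (_ == _).
Qed.

Lemma nu_coef_mod4 L M : M = (6 * L + 1)%N -> (forall m, m ^ 2 <> M)%N ->
  exists r : int, (nu_trunc M.+1 'X)`_(2 * L)
    = 2 * (nreps 6 M + nreps 12 M)%:Z + 4 * r.
Proof.
move=> def_M nsq.
have [||r ->] := @nu_trunc_coef_mod4 M.+1 (2 * L)%N; first by lia.
  by rewrite oddM.
rewrite coef_pentagonal_nonsquare => [|m]; last by have := nsq m; lia.
rewrite [(square_theta _ _ + _) * _]mulrDl coefD.
have [r1 ->] := @coef_theta_pentagonal 2 L M isT isT def_M.
have [r2 ->] := @coef_theta_pentagonal 4 L M isT isT def_M.
by exists (r1 + r2 + r); rewrite PoszD; ring.
Qed.

(** * Odd strongly unimodal sequences modulo 4 *)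

Fixpoint odd_increasing m : seq (seq nat) :=
  if m is m'.+1 then
    odd_increasing m' ++ [seq rcons a m'.*2.+1 | a <- odd_increasing m']
  else [:: [::]].

Lemma odd_increasingP m a :
  (a \in odd_increasing m) =
  [&& sorted ltn a, all odd a & all (fun i => i < m.*2)%N a].
Proof.
rewrite (sorted_pairwise ltn_trans).
elim: m a => [|m IHm] a; first by case: a => //= x a; rewrite !andbF.
rewrite mem_cat IHm; apply/orP/idP => [[/and3P[-> ->]|/mapP[b]]|].
- by apply: sub_all => i; rewrite doubleS; lia.
- rewrite IHm => /and3P[inc_b odd_b lt_b] ->.
  rewrite pairwise_rcons !all_rcons inc_b odd_b /= odd_double doubleS ltnSn !andbT.
  by apply/andP; split; apply: sub_all lt_b => i /=; lia.
case: (lastP a) => [_|b x]; first by left.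
rewrite pairwise_rcons !all_rcons => /and3P[/andP[lt_b inc_b] /andP[odd_x odd_b]].
case/andP=> lt_x lt_b2; have [ltxm|lemx] := ltnP x m.*2.
  left; rewrite lt_b inc_b odd_x odd_b /=.
  by apply: sub_all lt_b => i /= /ltn_trans; apply.
have def_x : x = m.*2.+1 by move: odd_x lt_x lemx; lia.
right; apply/mapP; exists b; last by rewrite def_x.
rewrite IHm inc_b odd_b; apply/allP => i b_i.
by have := allP lt_b i b_i; have := allP odd_b i b_i; rewrite def_x /=; lia.
Qed.

Lemma odd_increasing_uniq m : uniq (odd_increasing m).
Proof.
elim: m => //= m IHm; rewrite cat_uniq IHm map_inj_uniq ?IHm; last first.
  by move=> a b /rcons_inj[].
rewrite andbT; apply/hasPn => _ /mapP[a _ ->].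
rewrite odd_increasingP !all_rcons ltnNge; apply/and3P=> -[_ _ /andP[]]; lia.
Qed.

Lemma odd_increasing_gf m :
  \sum_(a <- odd_increasing m) ('X : {poly int}) ^+ sumn a = qpoch 'X ('X ^+ 2) m.
Proof.
elim: m => [|m IHm]; first by rewrite big_seq1 /qpoch big_ord0.
rewrite big_cat big_map /= IHm qpochS mulrDr mulr1; congr (_ + _).
rewrite -IHm mulr_suml; apply: eq_bigr => a _.
by rewrite sumn_rcons exprD exprS -mul2n exprM.
Qed.

Definition unimodal_list N : seq (seq nat) :=
  [seq p.1 ++ m.*2.+1 :: rev p.2 | m <- iota 0 N,
    p <- [seq (a, b) | a <- odd_increasing m, b <- odd_increasing m]].

(** The peak is the strict maximum, so it, its position and hence both flanks can be read off the
    sequence. *)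
Lemma unimodal_list_uniq N : uniq (unimodal_list N).
Proof.
apply: allpairs_uniq_dep; first exact: iota_uniq.
  by move=> m _; apply: allpairs_uniq => [||[a b] [a' b'] _ _]; rewrite ?odd_increasing_uniq.
set st := [seq Tagged _ _ | m <- _, p <- _].
have mem_st u : u \in st ->
    all (fun i => i < (tag u).*2.+1)%N ((tagged u).1 ++ rev (tagged u).2).
  case/allpairsPdep=> m [p [_ p_in def_u]].
  have [-> ->] : tag u = m /\ tagged u = p :> seq nat * seq nat.
    have /= := congr1 (fun v => (tag v : nat, tagged v : seq nat * seq nat)) def_u.
    by case.
  case/allpairsP: p_in => -[a b] /= [a_m b_m ->]; rewrite all_cat all_rev /=.
  move: a_m b_m; rewrite !odd_increasingP => /and3P[_ _ lt_a] /and3P[_ _ lt_b].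
  by apply/andP; split; [apply: sub_all lt_a | apply: sub_all lt_b] => i; apply: leqW.
move=> [m [a b]] [m' [a' b']] /mem_st /= lt_ab /mem_st /= lt_ab' E.
have peak_le n n' c c' d d' : (c ++ n.*2.+1 :: d = c' ++ n'.*2.+1 :: d')%N ->
    all (fun i => i < n'.*2.+1)%N (c' ++ d') -> (n <= n')%N.
  move=> Ec lt_c; have: n.*2.+1 \in c' ++ n'.*2.+1 :: d'.
    by rewrite -Ec mem_cat mem_head orbT.
  rewrite mem_cat inE orbCA => /predU1P[|]; first by lia.
  by rewrite -mem_cat => /(allP lt_c); lia.
have def_m : m = m'.
  by apply/eqP; rewrite eqn_leq (peak_le _ _ _ _ _ _ E) // (peak_le _ _ _ _ _ _ (esym E)).
rewrite -{m'}def_m in E lt_ab' *.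
have index_peak c d : all (fun i => i < m.*2.+1)%N (c ++ rev d) ->
    index m.*2.+1 (c ++ m.*2.+1 :: rev d) = size c.
  rewrite all_cat => /andP[lt_c _]; rewrite index_cat ifN /= ?eqxx ?addn0 //.
  by apply/negP => /(allP lt_c); rewrite ltnn.
have /eqP := E; rewrite eqseq_cat -1?(index_peak a b) -1?(index_peak a' b') ?E //.
by rewrite eqseq_cons => /and3P[/eqP-> _ /eqP/(can_inj revK)->].
Qed.

Lemma sorted_ltn_rcons a c :
  sorted ltn (rcons a c) = all (fun i => i < c)%N a && sorted ltn a.
Proof. by rewrite !(sorted_pairwise ltn_trans) pairwise_rcons. Qed.

Lemma path_gtn c b : path gtn c b = sorted ltn (rcons (rev b) c).
Proof. by rewrite -rev_cons rev_sorted. Qed.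

Lemma unimodal_listP N s : (sumn s < N)%N ->
  (s \in unimodal_list N) = odd_strongly_unimodal s.
Proof.
move=> lt_sN; apply/allpairsPdep/odd_strongly_unimodalP.
  case=> m [p [_ /allpairsP[[a b] /= [a_m b_m ->]] ->]] /=.
  move: a_m b_m; rewrite !odd_increasingP.
  move=> /and3P[inc_a odd_a lt_a] /and3P[inc_b odd_b lt_b].
  rewrite all_cat /= all_rev odd_a odd_b odd_double; split=> //.
  exists a, m.*2.+1, (rev b).
  rewrite path_gtn revK !sorted_ltn_rcons inc_a inc_b.
  by rewrite (sub_all _ lt_a) ?(sub_all _ lt_b) // => i; apply: leqW.
case=> odd_s [a [c [b [def_s]]]].
rewrite /= path_gtn !sorted_ltn_rcons => /andP[lt_a inc_a] /andP[lt_b inc_b].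
move: odd_s; rewrite def_s all_cat /= => /and3P[odd_a odd_c odd_b].
have def_c : c = c./2.*2.+1 by rewrite -{1}(odd_double_half c) odd_c.
exists c./2, (a, rev b); rewrite revK -def_c; split=> //.
  rewrite mem_iota /=; move: lt_sN; rewrite def_s sumn_cat /=; lia.
apply/allpairsP; exists (a, rev b); rewrite !odd_increasingP inc_a inc_b odd_a /=.
rewrite all_rev odd_b; split=> //.
  apply/allP => i ai; have := allP lt_a i ai; have := allP odd_a i ai.
  by move: odd_c def_c => /=; lia.
apply/allP => i bi; have := allP lt_b i bi.
have : odd i by move: bi; rewrite mem_rev => /(allP odd_b).
by move: odd_c def_c => /=; lia.
Qed.

Lemma ou_star_coef n N : (n < N)%N -> (ou_star n)%:Z =
  (\sum_(m < N) 'X ^+ m.*2.+1 * qpoch 'X ('X ^+ 2) m ^+ 2 : {poly int})`_n.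
Proof.
move=> ltnN.
rewrite (@ou_star_size n [seq s <- unimodal_list N | sumn s == n]); first last.
- move=> s; rewrite mem_filter; split=> [/andP[/eqP def_n]|[osu_s [def_n]]].
    by rewrite unimodal_listP def_n // => osu_s; split.
  by rewrite unimodal_listP -def_n ?eqxx.
- by rewrite filter_uniq ?unimodal_list_uniq.
have -> : \sum_(m < N) 'X ^+ m.*2.+1 * qpoch 'X ('X ^+ 2) m ^+ 2 =
    \sum_(s <- unimodal_list N) 'X ^+ sumn s :> {poly int}.
  rewrite big_allpairs_dep.
  rewrite -(big_mkord xpredT (fun m => 'X ^+ m.*2.+1 * qpoch 'X ('X ^+ 2) m ^+ 2)).
  rewrite /index_iota subn0; apply: eq_bigr => m _.
  rewrite big_allpairs -!odd_increasing_gf expr2 big_distrlr mulr_sumr /=.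
  apply: eq_bigr => a _; rewrite mulr_sumr; apply: eq_bigr => b _.
  by rewrite sumn_cat /= sumn_rev !exprD; ring.
rewrite coef_sum -sum1_size big_filter big_mkcond -natz natr_sum.
by apply: eq_bigr => s _; rewrite coefXn eq_sym; case: eqP.
Qed.

(** Each factor is [(1 + w)^2 = (1 + w^2) + 2 w] with [w] an odd power of [X]. Products of two cross
    terms are multiples of 4, so modulo 4 only twice an odd polynomial is added. *)
Lemma qpoch_sqr_mod4 m : exists O R : {poly int}, qpoch 'X ('X ^+ 2) m ^+ 2 =
  qpoch 'X ('X ^+ 2) m \Po 'X^2 + 2 * ('X * (O \Po 'X^2)) + 4 * R.
Proof.
elim: m => [|m [O [R E]]].
  by exists 0, 0; rewrite /qpoch !big_ord0 -polyC1 comp_polyC comp_poly0; ring.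
set V := qpoch 'X ('X ^+ 2) m in E *.
have VS : qpoch 'X ('X ^+ 2) m.+1 = V * (1 + 'X^(m.*2.+1)) :> {poly int}.
  by rewrite qpochS -exprM -exprS mul2n.
exists (O * (1 + 'X^(m.*2.+1)) + V * 'X^m).
exists (R * (1 + 'X^(m.*2.+1)) ^+ 2 + 'X * (O \Po 'X^2) * 'X^(m.*2.+1)).
rewrite VS exprMn E !(comp_polyD, comp_polyM) -polyC1 comp_polyC polyC1.
have -> : 'X^(m.*2.+1) \Po 'X^2 = ('X^(m.*2.+1)) ^+ 2 :> {poly int}.
  by rewrite comp_Xn_poly -!exprM mulnC.
have -> : 'X^m \Po 'X^2 = 'X^(m.*2) :> {poly int}.
  by rewrite comp_Xn_poly -!exprM mul2n.
by rewrite ['X^(m.*2.+1)]exprS; ring.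
Qed.

(** Times [X^(2m+1)], the odd polynomial of [qpoch_sqr_mod4] becomes even; at an odd exponent only
    [X nu(X^2)] is left modulo 4. *)
Lemma ou_star_mod4 K N : (K.*2.+1 < N)%N ->
  exists r : int, (ou_star K.*2.+1)%:Z = (nu_trunc N 'X)`_K + 4 * r.
Proof.
move=> ltKN; rewrite (ou_star_coef ltKN).
have [O [R E]] : exists O R : {poly int},
    \sum_(m < N) 'X ^+ m.*2.+1 * qpoch 'X ('X ^+ 2) m ^+ 2 =
    'X * (nu_trunc N 'X \Po 'X^2) + 2 * (O \Po 'X^2) + 4 * R.
  rewrite /nu_trunc; elim: (N) => [|n [O [R E]]].
    by exists 0, 0; rewrite !big_ord0 !comp_poly0; ring.
  have [O' [R' E']] := qpoch_sqr_mod4 n.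
  exists (O + 'X^(n.+1) * O'), (R + 'X^(n.*2.+1) * R').
  rewrite !big_ord_recr /= E E' !comp_polyD !comp_polyM.
  have compXn i : 'X^i \Po 'X^2 = 'X^i * 'X^i :> {poly int}.
    by rewrite comp_Xn_poly -exprM mulnC exprM expr2.
  by rewrite !compXn ['X^(n.*2.+1)]exprS -addnn exprD ['X^(n.+1)]exprS; ring.
exists R`_K.*2.+1; rewrite E !mulr_natl 2!coefD !coefMn coefXM /=.
rewrite !coef_comp_poly_Xn // !dvdn2 /= odd_double /=.
by rewrite mul0rn addr0 -muln2 mulnK.
Qed.

(** * Representations by binary quadratic forms *)

(** Strong induction on the size: a non-fixed [x] is removed together with [f x], a fixed one
    alone. *)
Lemma odd_size_involution (T : eqType) (f : T -> T) (s : seq T) : uniq s ->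
    {in s, forall x, f x \in s} -> {in s, forall x, f (f x) = x} ->
  odd (size s) = odd (count (fun x => f x == x) s).
Proof.
elim: {s}_.+1 {-2}s (ltnSn (size s)) => // n IHn [|x s] //= lt_sn.
case/andP=> x_s uniq_s fs ffs.
have [fx|fx] := eqVneq (f x) x.
  rewrite add1n /= (IHn s) // => y ys; last by rewrite ffs ?inE ?ys ?orbT.
  have ys' : y \in x :: s by rewrite inE ys orbT.
  have := fs y ys'; rewrite inE => /predU1P[fy|//].
  by move: x_s; rewrite -fx -fy ffs // ys.
have fxs : f x \in s by have := fs x (mem_head x s); rewrite inE (negbTE fx).
have ffx := ffs x (mem_head x s).
rewrite add0n (perm_size (perm_to_rem fxs)) (permP (perm_to_rem fxs)) /=.
rewrite ffx eq_sym (negbTE fx) add0n negbK.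
have mem_r y : y \in rem (f x) s = (y != f x) && (y \in s) by rewrite mem_rem_uniq ?inE.
rewrite (IHn (rem (f x) s)) ?rem_uniq //.
- by rewrite size_rem //; move: fxs lt_sn; case: (s) => //= *; lia.
- move=> y; rewrite !mem_r => /andP[ne_y ys].
  have ys' : y \in x :: s by rewrite inE ys orbT.
  apply/andP; split.
    by apply: contra x_s => /eqP /(congr1 f); rewrite ffs // ffx => <-.
  have := fs y ys'; rewrite inE => /predU1P[fy|//].
  by case/eqP: ne_y; rewrite -fy ffs.
- by move=> y; rewrite mem_r => /andP[_ ys]; rewrite ffs // inE ys orbT.
Qed.

Definition rep_list (D M : nat) : seq (nat * nat) :=
  [seq p <- [seq (x, y) | x <- iota 0 M.+1, y <- iota 0 M.+1] |
    [&& 0 < p.1, 0 < p.2 & p.1 ^ 2 + D * p.2 ^ 2 == M]%N].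

Lemma nreps_size D M : nreps D M = size (rep_list D M).
Proof.
pose F x y : nat := [&& 0 < x, 0 < y & x ^ 2 + D * y ^ 2 == M]%N.
rewrite /rep_list size_filter -sum1_count big_mkcond big_allpairs.
rewrite -[LHS]/(\sum_(x < M.+1) \sum_(y < M.+1) F x y)%N.
rewrite -(big_mkord xpredT (fun x => \sum_(y < M.+1) F x y))%N /index_iota subn0.
apply: eq_bigr => x _; rewrite -(big_mkord xpredT (F x)) /index_iota subn0.
by apply: eq_bigr => y _; rewrite /F /=; case: ifP.
Qed.

Lemma rep_list_uniq D M : uniq (rep_list D M).
Proof.
apply/filter_uniq/allpairs_uniq; rewrite ?iota_uniq //.
by move=> [x y] [x' y'] _ _.
Qed.

Lemma mem_rep_list D M x y : (0 < D)%N -> ((x, y) \in rep_list D M) =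
  [&& 0 < x, 0 < y & x ^ 2 + D * y ^ 2 == M]%N.
Proof.
move=> D_gt0; rewrite mem_filter; set R := _ \in _; rewrite /=.
case: and3P => [[x_gt0 y_gt0 /eqP def_M]|//]; rewrite {}/R andTb.
apply/allpairsP; exists (x, y); rewrite !mem_iota /=.
by split=> //; nia.
Qed.

Section NormEquation.
Variables l k c1 c2 u v : nat.
Hypotheses (l_prime : prime l) (l_gt4 : (4 < l)%N) (ldvdn_k : ~~ (l %| k)%N).
Hypotheses (u_gt0 : (0 < u)%N) (v_gt0 : (0 < v)%N) (c1_gt0 : (0 < c1)%N).
Hypotheses (c1_small : (c1 < 5)%N) (c2_gt0 : (0 < c2)%N).
Hypothesis def_l : l = (c1 * u ^ 2 + c2 * v ^ 2)%N.
Local Notation D := (c1 * c2)%N.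
Local Notation M := (l * k)%N.
Hypothesis ndvd_D : ~~ (D %| M)%N.

Let a : int := c1%:Z * u%:Z ^+ 2 - c2%:Z * v%:Z ^+ 2.
Let b : int := 2 * u%:Z * v%:Z.

(** [a + b sqrt(-D)] is the square of [beta = u sqrt c1 + v sqrt(- c2)], which has norm [l]. *)
Lemma norm_a_b : a ^+ 2 + D%:Z * b ^+ 2 = l%:Z ^+ 2.
Proof. by rewrite /a /b def_l !PoszM PoszD !PoszM; ring. Qed.

Lemma euclid_dvdz (m n : int) : (l %| m * n)%Z = (l %| m)%Z || (l %| n)%Z.
Proof. by rewrite !dvdzE abszM /= Euclid_dvdM. Qed.

Lemma ndvd_small n : (0 < n < l)%N -> (l %| n%:Z)%Z = false.
Proof. by move=> /andP[n_gt0 ltnl]; rewrite dvdzE /= gtnNdvd. Qed.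

(** Modulo [l], [a] is [a + l = 2 c1 u^2], whose factors are all positive and below [l]. *)
Lemma ndvd_a : (l %| a)%Z = false.
Proof.
have ult : (u < l)%N by rewrite def_l; nia.
apply/negP => dvd_a; have := rpredD dvd_a (dvdzz l).
have -> : a + l = 2 * c1%:Z * u%:Z * u%:Z.
  by rewrite /a def_l PoszD !PoszM; ring.
by rewrite !euclid_dvdz !ndvd_small //; apply/andP; split=> //; lia.
Qed.

Lemma ndvd_b : (l %| b)%Z = false.
Proof.
have ult : (u < l)%N by rewrite def_l; nia.
have vlt : (v < l)%N by rewrite def_l; nia.
by rewrite /b !euclid_dvdz !ndvd_small ?u_gt0 ?v_gt0 //=; lia.
Qed.

(** Otherwise [l] divides both [x] and [y], so [l^2] divides [M]. Thus at most one of [(x, y)] and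
    [(x, - y)] is [adapted]. *)
Lemma dvd_both_false (x y : int) : x ^+ 2 + D%:Z * y ^+ 2 = M%:Z ->
  (l %| x * b + y * a)%Z -> (l %| x * b - y * a)%Z -> False.
Proof.
move=> def_M dvd_p dvd_m.
have dvd2 : (l %| 2)%Z = false by rewrite (@ndvd_small 2) //; lia.
have dvd_x : (l %| x)%Z.
  have := rpredD dvd_p dvd_m.
  have -> : x * b + y * a + (x * b - y * a) = 2 * x * b by ring.
  by rewrite (euclid_dvdz (2 * x)) (euclid_dvdz 2) dvd2 ndvd_b orbF.
have dvd_y : (l %| y)%Z.
  have := rpredB dvd_p dvd_m.
  have -> : x * b + y * a - (x * b - y * a) = 2 * y * a by ring.
  by rewrite (euclid_dvdz (2 * y)) (euclid_dvdz 2) dvd2 ndvd_a orbF.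
case/dvdzP: dvd_x => x' def_x; case/dvdzP: dvd_y => y' def_y.
have def_k : k%:Z = l%:Z * (x' ^+ 2 + D%:Z * y' ^+ 2).
  have l_neq0 : l%:Z != 0 by move: l_gt4; lia.
  by apply: (mulfI l_neq0); rewrite -PoszM -def_M def_x def_y; ring.
by move: ldvdn_k; rewrite -[(_ %| _)%N]/(l %| k%:Z)%Z def_k dvdz_mulr.
Qed.


(* [(x, y)] stands for [z = x + y sqrt(-D)] of norm [M] lying above a fixed
   prime divisor of [l]; [rotate] multiplies [z] by [(a + b sqrt(-D)) / l],
   conjugates, and normalises the sign of the real part. *)
Definition adapted (z : int * int) : bool :=
  [&& 0 < z.1, z.1 ^+ 2 + D%:Z * z.2 ^+ 2 == M & (l %| z.1 * b + z.2 * a)%Z].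

Definition rotate (z : int * int) : int * int :=
  let X := ((z.1 * a - D%:Z * z.2 * b) %/ l)%Z in
  let Y := ((z.1 * b + z.2 * a) %/ l)%Z in
  if 0 < X then (X, - Y) else (- X, Y).

Let l_neq0 : l%:Z != 0. Proof. by move: l_gt4; lia. Qed.

(** Multiplicativity of the norm makes [l] divide the real part too, and [X = 0] would make [D]
    divide [M]. The last two equations are multiplication back by [a - b sqrt(-D)]. *)
Lemma rotateP x y : adapted (x, y) -> exists X Y : int,
  [/\ rotate (x, y) = if 0 < X then (X, - Y) else (- X, Y), X != 0,
      x * a - D%:Z * y * b = X * l & x * b + y * a = Y * l] /\
  [/\ X ^+ 2 + D%:Z * Y ^+ 2 = M, X * a + D%:Z * Y * b = x * l
    & X * b - Y * a = - y * l].
Proof.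
case/and3P=> /= x_gt0 /eqP def_M /dvdzP[Y def_Y].
have normE : (x * a - D%:Z * y * b) ^+ 2 + D%:Z * (x * b + y * a) ^+ 2
    = l%:Z ^+ 2 * M.
  by rewrite -def_M -norm_a_b; ring.
have /dvdzP[X def_X] : (l %| x * a - D%:Z * y * b)%Z.
  suff: (l %| (x * a - D%:Z * y * b) ^+ 2)%Z by rewrite expr2 euclid_dvdz orbb.
  have -> : (x * a - D%:Z * y * b) ^+ 2
      = l%:Z * (l%:Z * M - D%:Z * Y ^+ 2 * l%:Z).
    by apply: (addIr (D%:Z * (x * b + y * a) ^+ 2)); rewrite normE def_Y; ring.
  exact: dvdz_mulr (dvdzz _).
have norm_XY : X ^+ 2 + D%:Z * Y ^+ 2 = M.
  apply: (mulfI (expf_neq0 2 l_neq0)); rewrite -normE def_X def_Y; ring.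
have X_neq0 : X != 0.
  apply: (contra _ ndvd_D) => /eqP X0; rewrite -[(_ %| _)%N]/(D %| M%:Z)%Z.
  by rewrite -norm_XY X0 expr0n add0r dvdz_mulr.
exists X, Y; split; split=> //.
- by rewrite /rotate /= def_X def_Y !mulzK.
- apply: (mulIf l_neq0).
  transitivity (a * (X * l%:Z) + D%:Z * b * (Y * l%:Z)); first by ring.
  by rewrite -def_X -def_Y -[RHS]mulrA -expr2 -norm_a_b; ring.
- apply: (mulIf l_neq0).
  transitivity (b * (X * l%:Z) - a * (Y * l%:Z)); first by ring.
  by rewrite -def_X -def_Y -[RHS]mulrA -expr2 -norm_a_b; ring.
Qed.

Lemma rotate_adapted z : adapted z -> adapted (rotate z).
Proof.
case: z => x y /rotateP[X [Y [[-> X_neq0 _ _] [norm_XY _ E]]]].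
rewrite /adapted; have [X_gt0|X_le0] /= := ltP 0 X.
  by rewrite X_gt0 sqrrN norm_XY eqxx mulNr E dvdz_mull.
rewrite oppr_gt0 lt_neqAle X_neq0 X_le0 sqrrN norm_XY eqxx /=.
have -> : - X * b + Y * a = - (X * b - Y * a) by ring.
by rewrite E mulNr opprK dvdz_mull.
Qed.

Lemma rotateK z : adapted z -> rotate (rotate z) = z.
Proof.
case: z => x y xy_ok; have /and3P[/= x_gt0 _ _] := xy_ok.
have [X [Y [[-> X_neq0 _ _] [_ E1 E2]]]] := rotateP xy_ok.
rewrite /rotate; have [X_gt0|X_le0] /= := ltP 0 X.
  have -> : X * a - D%:Z * - Y * b = x * l%:Z by rewrite -E1; ring.
  have -> : X * b + - Y * a = - y * l%:Z by rewrite -E2; ring.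
  by rewrite !mulzK // x_gt0 opprK.
have -> : - X * a - D%:Z * Y * b = - x * l%:Z.
  by rewrite [RHS]mulNr -E1; ring.
have -> : - X * b + Y * a = y * l%:Z.
  by rewrite -[y in RHS]opprK [RHS]mulNr -E2; ring.
by rewrite !mulzK // oppr_gt0 ltNge ltW //= opprK.
Qed.

(** For [z = x + y sqrt(-D)], [z beta] is [(u x - c2 v y) sqrt c1 + (v x + c1 u y) sqrt(- c2)], and
    fixing [z] makes one of these coordinates vanish. The computation rests on [l - a = 2 c2 v^2]
    and [l + a = 2 c1 u^2]. *)
Lemma rotate_fixed x y : adapted (x, y) -> rotate (x, y) = (x, y) ->
  v%:Z * x = - (c1%:Z * u%:Z * y) \/ u%:Z * x = c2%:Z * v%:Z * y.
Proof.
move=> /rotateP[X [Y [[-> _ E1 E2] _]]]; have [_|_] := ltP 0 X => -[defX defY].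
  left; rewrite defX in E1; have c2v_neq0 : 2 * c2%:Z * v%:Z != 0 by nia.
  apply: (mulfI c2v_neq0).
  transitivity (x * l%:Z - x * a); first by rewrite /a def_l PoszD !PoszM; ring.
  by rewrite -E1 /b PoszM; ring.
right; have def_X : X = - x by rewrite -defX opprK.
rewrite def_X in E1; have c1u_neq0 : 2 * c1%:Z * u%:Z != 0 by nia.
apply: (mulfI c1u_neq0).
transitivity (x * l%:Z + x * a); first by rewrite /a def_l PoszD !PoszM; ring.
by rewrite -[x * l%:Z]opprK -mulNr -E1 /b PoszM; ring.
Qed.

(** Norm of [z beta], equal to [M l]. When one coordinate vanishes, [k] becomes [c1] or [c2] times a
    square. *)
Lemma norm_product (x y : int) : x ^+ 2 + D%:Z * y ^+ 2 = M ->
  c1%:Z * (u%:Z * x - c2%:Z * v%:Z * y) ^+ 2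
    + c2%:Z * (c1%:Z * u%:Z * y + v%:Z * x) ^+ 2 = l%:Z ^+ 2 * k%:Z.
Proof.
move=> def_M; have -> : l%:Z ^+ 2 * k%:Z = l%:Z * M by rewrite PoszM expr2 mulrA.
by rewrite -def_M {1}def_l PoszD !PoszM; ring.
Qed.

(** Exactly one of [(x, y)] and [(x, - y)] is adapted, so this is a copy of the positive solutions
    on which [rotate] acts. *)
Definition adapted_list : seq (int * int) :=
  [seq (p.1%:Z, if (l %| p.1%:Z * b + p.2%:Z * a)%Z then p.2%:Z else - p.2%:Z)
  | p <- rep_list D M].

Lemma adapted_listP z : (z \in adapted_list) = adapted z.
Proof.
have D_gt0 : (0 < D)%N by rewrite muln_gt0 c1_gt0.
apply/mapP/idP => [[[x y]]|].
  rewrite mem_rep_list // => /and3P[x_gt0 y_gt0 /eqP def_M] ->.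
  have def_Mz : x%:Z ^+ 2 + D%:Z * y%:Z ^+ 2 = M by lia.
  rewrite /adapted /=; case: ifP => [dvd_p|ndvd_p].
    by rewrite ltz_nat x_gt0 def_Mz eqxx dvd_p.
  rewrite ltz_nat x_gt0 sqrrN def_Mz eqxx /= mulNr.
  (* The product is [M b^2 - l^2 y^2], so the prime [l] divides one of its factors. *)
  have: (l %| (x%:Z * b + y%:Z * a) * (x%:Z * b - y%:Z * a))%Z.
    have -> : (x%:Z * b + y%:Z * a) * (x%:Z * b - y%:Z * a)
        = l%:Z * (k%:Z * b ^+ 2 - l%:Z * y%:Z ^+ 2).
      transitivity (M%:Z * b ^+ 2 - y%:Z ^+ 2 * l%:Z ^+ 2); last first.
        by rewrite PoszM; ring.
      by rewrite -def_Mz -norm_a_b; ring.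
    exact: dvdz_mulr (dvdzz _).
  by rewrite euclid_dvdz ndvd_p.
case: z => x y /and3P[/= x_gt0 /eqP def_M dvd_p].
have y_neq0 : y != 0.
  apply/eqP => y0; apply: (dvd_both_false def_M dvd_p).
  by move: dvd_p; rewrite y0 !mul0r subr0.
exists (`|x|, `|y|)%N.
  rewrite mem_rep_list // !absz_gt0 y_neq0 gt_eqF //= -eqz_nat PoszD PoszM.
  by rewrite -def_M; apply/eqP; lia.
rewrite /= gtz0_abs //; have [y_gt0|y_le0] := ltP 0 y.
  by rewrite gtz0_abs // dvd_p.
rewrite lez0_abs // opprK mulNr ifF //; apply/negP => dvd_m.
exact: dvd_both_false def_M dvd_p dvd_m.
Qed.

Lemma adapted_list_uniq : uniq adapted_list.
Proof.
rewrite map_inj_uniq ?rep_list_uniq // => -[x y] [x' y'] /= [-> E].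
by move: E; case: ifP => _; case: ifP => _ E; congr (_, _); lia.
Qed.

Lemma odd_nreps_fixed :
  odd (nreps D M) = odd (count (fun z => rotate z == z) adapted_list).
Proof.
rewrite nreps_size -(size_map (fun p => (p.1%:Z,
  if (l %| p.1%:Z * b + p.2%:Z * a)%Z then p.2%:Z else - p.2%:Z))).
apply: odd_size_involution; rewrite -/adapted_list.
- exact: adapted_list_uniq.
- by move=> z; rewrite !adapted_listP; apply: rotate_adapted.
- by move=> z; rewrite !adapted_listP; apply: rotateK.
Qed.

End NormEquation.

Section Parity.
Variables l k c1 c2 u v : nat.
Hypotheses (l_prime : prime l) (l_gt4 : (4 < l)%N) (ldvdn_k : ~~ (l %| k)%N).
Hypotheses (u_gt0 : (0 < u)%N) (v_gt0 : (0 < v)%N) (c1_gt0 : (0 < c1)%N).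
Hypotheses (c1_small : (c1 < 5)%N) (c2_gt0 : (0 < c2)%N).
Hypothesis def_l : l = (c1 * u ^ 2 + c2 * v ^ 2)%N.
Hypothesis ndvd_D : ~~ (c1 * c2 %| l * k)%N.
Hypothesis k_not_c2 : forall w, (c2 * w ^ 2)%N <> k.

Local Notation rot := (rotate l c1 c2 u v).

Lemma scaled_square_eq (c : nat) (W : int) : (0 < c < l)%N ->
  c%:Z * W ^+ 2 = l%:Z ^+ 2 * k%:Z -> exists2 w : nat, (c * w ^ 2)%N = k & `|W|%N = (l * w)%N.
Proof.
move=> c_range E.
have lW : (l %| W)%Z.
  have: (l %| c%:Z * (W * W))%Z.
    by rewrite -expr2 E expr2 -mulrA dvdz_mulr.
  rewrite !euclid_dvdz // orbb => /orP[|//].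
  by rewrite (ndvd_small c_range).
case/dvdzP: lW => w def_W; exists `|w|%N; last by rewrite def_W abszM mulnC.
have l_neq0 : l%:Z != 0 by move: l_gt4; lia.
have : c%:Z * w ^+ 2 = k%:Z.
  apply: (mulfI (expf_neq0 2 l_neq0)); by rewrite -[RHS]E def_W; ring.
by move=> /(congr1 absz); rewrite abszM abszX.
Qed.

Let c2_lt_l : (c2 < l)%N. Proof. by rewrite def_l; nia. Qed.

Lemma rotate_fixed_square x y : adapted l k c1 c2 u v (x, y) ->
    rot (x, y) = (x, y) ->
  exists w, [/\ (c1 * w ^ 2)%N = k, v%:Z * x = - (c1%:Z * u%:Z * y)
    & `|(u%:Z * x - c2%:Z * v%:Z * y)%R|%N = (l * w)%N].
Proof.
move=> xy_ok fix_xy; have /and3P[/= _ /eqP def_M _] := xy_ok.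
have E := norm_product def_l def_M.
case: (rotate_fixed l_prime l_gt4 ldvdn_k u_gt0 v_gt0 c1_gt0 c1_small c2_gt0
  def_l ndvd_D xy_ok fix_xy) => Exy.
  have [||w def_k def_W] := @scaled_square_eq c1 (u%:Z * x - c2%:Z * v%:Z * y).
  - by rewrite c1_gt0 (leq_trans c1_small l_gt4).
  - by rewrite -E Exy subrr expr0n mulr0 addr0.
  by exists w.
have [||w def_k _] := @scaled_square_eq c2 (c1%:Z * u%:Z * y + v%:Z * x).
- by rewrite c2_gt0 c2_lt_l.
- by rewrite -E Exy subrr expr0n mulr0 add0r.
by case: (k_not_c2 def_k).
Qed.

Lemma even_nreps : (forall w, (c1 * w ^ 2)%N <> k) ->
  ~~ odd (nreps (c1 * c2) (l * k)).
Proof.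
move=> k_not_c1.
rewrite (odd_nreps_fixed l_prime l_gt4 ldvdn_k u_gt0 v_gt0 c1_gt0 c1_small c2_gt0
  def_l ndvd_D).
rewrite (_ : count _ _ = 0)%N //; apply/eqP; rewrite -leqn0 leqNgt -has_count.
apply/hasPn => -[x y]; rewrite adapted_listP // => xy_ok.
apply/eqP => /(rotate_fixed_square xy_ok)[w [def_k _ _]].
exact: k_not_c1 def_k.
Qed.

(** The only fixed point is [m (u - v sqrt(-D))], that is [m] times the conjugate of [beta]. *)
Lemma odd_nreps m : c1 = 1%N -> k = (m ^ 2)%N -> odd (nreps (c1 * c2) (l * k)).
Proof.
move=> c1_1 def_k.
have m_gt0 : (0 < m)%N.
  by case: m def_k => // k0; move: ldvdn_k; rewrite k0 dvdn0.
rewrite (odd_nreps_fixed l_prime l_gt4 ldvdn_k u_gt0 v_gt0 c1_gt0 c1_small c2_gt0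
  def_l ndvd_D).
pose z0 : int * int := (m%:Z * u%:Z, - (m%:Z * v%:Z)).
have z0_ok : adapted l k c1 c2 u v z0.
  rewrite /adapted /=; apply/and3P; split; first by nia.
    by rewrite def_k def_l c1_1; lia.
  apply/dvdzP; exists (m%:Z * v%:Z).
  by rewrite def_l c1_1 PoszD !PoszM; ring.
have fix_z0 : rot z0 = z0.
  have l_neq0 : l%:Z != 0 by move: l_gt4; lia.
  rewrite /rotate /=.
  have -> : m%:Z * u%:Z * (c1%:Z * u%:Z ^+ 2 - c2%:Z * v%:Z ^+ 2)
      - (c1 * c2)%N%:Z * - (m%:Z * v%:Z) * (2 * u%:Z * v%:Z) = m%:Z * u%:Z * l%:Z.
    by rewrite def_l c1_1 PoszD !PoszM; ring.
  have -> : m%:Z * u%:Z * (2 * u%:Z * v%:Z)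
      + - (m%:Z * v%:Z) * (c1%:Z * u%:Z ^+ 2 - c2%:Z * v%:Z ^+ 2) = m%:Z * v%:Z * l%:Z.
    by rewrite def_l c1_1 PoszD !PoszM; ring.
  by rewrite !mulzK // ifT //; nia.
rewrite (eq_in_count (a2 := pred1 z0)).
  by rewrite count_uniq_mem ?adapted_list_uniq // adapted_listP // z0_ok.
move=> [x y]; rewrite adapted_listP //= => xy_ok.
apply/eqP/eqP=> [/(rotate_fixed_square xy_ok)[w [def_k' Exy def_W]]|->//].
have /and3P[/= x_gt0 _ _] := xy_ok.
have def_w : w = m by move: def_k'; rewrite def_k c1_1 mul1n => /eqP; rewrite eqn_exp2r // => /eqP.
have u_neq0 : u%:Z != 0 by rewrite eqz_nat -lt0n.
have l_neq0 : l%:Z != 0 by rewrite eqz_nat -lt0n prime_gt0.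
have Exl : x * l%:Z = u%:Z * (u%:Z * x - c2%:Z * v%:Z * y).
  rewrite def_l c1_1 PoszD !PoszM.
  transitivity (u%:Z * (u%:Z * x) + c2%:Z * v%:Z * (v%:Z * x)); first by ring.
  by rewrite Exy c1_1; ring.
(* The fixed-point equations determine [(x, y)] up to sign; the second sign contradicts [x > 0]. *)
have [eqW|eqW] : u%:Z * x - c2%:Z * v%:Z * y = l%:Z * m%:Z \/
    u%:Z * x - c2%:Z * v%:Z * y = - (l%:Z * m%:Z).
  move: def_W; rewrite def_w; case: (u%:Z * x - _) => n /= def_n.
    by left; rewrite def_n PoszM.
  by right; rewrite NegzE def_n PoszM.
  have def_x : x = m%:Z * u%:Z.
    by apply: (mulIf l_neq0); rewrite Exl eqW; ring.
  rewrite /z0 -def_x; congr (_, _); apply: (mulfI u_neq0).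
  transitivity (- (v%:Z * x)); first by rewrite Exy c1_1; ring.
  by rewrite def_x; ring.
have def_x : x = - (m%:Z * u%:Z).
  by apply: (mulIf l_neq0); rewrite Exl eqW; ring.
by move: x_gt0; rewrite def_x oppr_gt0 ltNge mulr_ge0.

Qed.

End Parity.

(** * Thue's lemma and primes represented by the forms *)

Lemma prime_between_squares l : prime l -> exists r, (r ^ 2 < l < r.+1 ^ 2)%N.
Proof.
move=> l_prime; suff [r /andP[]] : exists r, (r ^ 2 <= l < r.+1 ^ 2)%N.
  rewrite leq_eqVlt => /predU1P[def_l _|lt1 lt2]; last by exists r; rewrite lt1.
  move: l_prime; rewrite -def_l expnS expn1.
  case: r {def_l} => // -[//|r] /primeP[_ /(_ r.+2 (dvdn_mulr _ (dvdnn _)))].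
  by case/orP=> /eqP //; nia.
elim: l {l_prime} => [|n [r /andP[le1 lt2]]]; first by exists 0%N.
have [lt3|le3] := ltnP n.+1 (r.+1 ^ 2)%N.
  by exists r; rewrite lt3 leqW.
by exists r.+1; rewrite le3; nia.
Qed.

Lemma distn_ord_le r (i j : 'I_r.+1) : (`|i%:Z - j%:Z| <= r)%N.
Proof. by have := ltn_ord i; have := ltn_ord j; lia. Qed.

Lemma thue_bound u v D l r t : (0 < D)%N -> (u <= r)%N -> (v <= r)%N ->
  (0 < u + v)%N -> (r ^ 2 < l)%N -> (u ^ 2 + D * v ^ 2 = t * l)%N -> (0 < t < D.+1)%N.
Proof.
move=> D_gt0 le_ur le_vr uv_gt0 lt_rl E.
have l_gt0 : (0 < l)%N by apply: leq_ltn_trans lt_rl.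
have le1 : (u ^ 2 <= r ^ 2)%N by rewrite leq_exp2r.
have le2 : (D * v ^ 2 <= D * r ^ 2)%N by rewrite leq_mul2l leq_exp2r // le_vr orbT.
have lt3 : (D * r ^ 2 < D * l)%N by rewrite ltn_pmul2l.
apply/andP; split; last by rewrite -(ltn_pmul2r l_gt0) -E mulSn; lia.
rewrite lt0n; apply: contraTneq uv_gt0 => t0; move/eqP: E.
by rewrite t0 addn_eq0 muln_eq0 !expn_eq0 /= !andbT (gtn_eqF D_gt0) => /andP[/eqP-> /eqP->].
Qed.

(** Pigeonhole: among more than [l] pairs [(i, j)] with entries at most [r < sqrt l], two share
    [i y + j x] modulo [l]. Their difference [(U, V)] satisfies [U^2 + D V^2 = 0] modulo [l], and
    its size bounds [t]. *)
Lemma thue (l D x y : nat) : prime l -> (0 < D)%N -> ~~ (l %| y)%N ->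
    (l %| x ^ 2 + D * y ^ 2)%N ->
  exists u v t, [/\ (u ^ 2 + D * v ^ 2 = t * l)%N & (0 < t < D.+1)%N].
Proof.
move=> l_prime D_gt0 ldvdn_y l_dvd.
have l_gt0 := prime_gt0 l_prime.
have [r /andP[lt_rl lt_lr]] := prime_between_squares l_prime.
pose f (p : 'I_r.+1 * 'I_r.+1) : 'I_l :=
  Ordinal (ltn_pmod (p.1 * y + p.2 * x) l_gt0).
have /injectivePn[[i j] [[i' j'] ne_p /(congr1 val) /= eq_f]] : ~~ injectiveb f.
  apply/negP => /injectiveP /leq_card; rewrite card_prod !card_ord; nia.
pose U : int := i%:Z - i'%:Z; pose V : int := j%:Z - j'%:Z.
have l_dvdUV : (l %| U * y%:Z + V * x%:Z)%Z.
  have -> : U * y%:Z + V * x%:Z = (i * y + j * x)%N%:Z - (i' * y + j' * x)%N%:Z.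
    by rewrite !PoszD !PoszM /U /V; ring.
  by rewrite -eqz_mod_dvd !modz_nat; apply/eqP; congr Posz.
have ndvd_y : (l %| y%:Z)%Z = false by apply: negbTE.
have : (l %| y%:Z * (y%:Z * (U ^+ 2 + D%:Z * V ^+ 2)))%Z.
  have -> : y%:Z * (y%:Z * (U ^+ 2 + D%:Z * V ^+ 2)) =
      (U * y%:Z + V * x%:Z) * (U * y%:Z - V * x%:Z)
      + V ^+ 2 * (x ^ 2 + D * y ^ 2)%N%:Z.
    by rewrite PoszD !PoszM; ring.
  by apply: rpredD; [apply: dvdz_mulr | apply: dvdz_mull].
rewrite !euclid_dvdz // ndvd_y /= => /dvdzP[t def_t].
have sqr_abs (z : int) : (`|z| ^ 2)%N%:Z = z ^+ 2.
  by rewrite -abszX gez0_abs ?sqr_ge0.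
have norm_ut : (`|U| ^ 2 + D * `|V| ^ 2)%N%:Z = t * l%:Z.
  by rewrite PoszD PoszM !sqr_abs.
have le_U : (`|U| <= r)%N by apply: distn_ord_le.
have le_V : (`|V| <= r)%N by apply: distn_ord_le.
have UV_gt0 : (0 < `|U| + `|V|)%N.
  rewrite lt0n addn_eq0 !absz_eq0 !subr_eq0; apply: contra ne_p.
  by case/andP=> /eqP[ei] /eqP[ej]; apply/eqP; congr (_, _); apply: val_inj.
have t_ge0 : 0 <= t by rewrite -(@pmulr_lge0 _ l%:Z) // -norm_ut.
case: t t_ge0 {def_t} norm_ut => // t _ [norm_ut].
exists `|U|%N, `|V|%N, t; split=> //.
exact: thue_bound D_gt0 le_U le_V UV_gt0 lt_rl norm_ut.
Qed.

Lemma prime_not_scaled_square l c w : prime l -> (4 < l)%N -> (c < 5)%N || (c == 6)%N ->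
  l <> (c * w ^ 2)%N.
Proof.
move=> l_prime l_gt4 lt_c7 def_l.
have w_gt0 : (0 < w)%N by case: w def_l => [|//]; move: l_gt4; rewrite muln0 => /[swap] ->.
have /primeP[_ /(_ w)] := l_prime.
have -> : (w %| l)%N by rewrite def_l dvdn_mull // expnS dvdn_mulr.
case/(_ isT)/orP=> /eqP def_w; last first.
  rewrite def_w in def_l; clear -def_l l_gt4.
  by case: c def_l => [|c] def_l; [lia | nia].
move: l_prime l_gt4; rewrite def_l def_w exp1n muln1.
by case: c lt_c7 {def_l} => [|[|[|[|[|[|[]]]]]]].
Qed.

Lemma prime_mod6 l : prime l -> (4 < l)%N -> (l %% 6 = 1 \/ l %% 6 = 5)%N.
Proof.
move=> l_prime l_gt4.
have l2 : ~~ (2 %| l)%N by rewrite dvdn_prime2 //; apply/eqP; lia.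
have l3 : ~~ (3 %| l)%N by rewrite dvdn_prime2 //; apply/eqP; lia.
by move: l2 l3; lia.
Qed.

Lemma norm_pos c1 c2 l u v : prime l -> (4 < l)%N -> (c1 < 5)%N || (c1 == 6)%N ->
  (c2 < 5)%N || (c2 == 6)%N ->
  l = (c1 * u ^ 2 + c2 * v ^ 2)%N -> (0 < u)%N && (0 < v)%N.
Proof.
move=> l_prime l_gt4 c1_small c2_small def_l; rewrite !lt0n -negb_or; apply/negP.
case/orP=> /eqP z0; move: def_l; rewrite z0 exp0n // muln0 ?addn0 ?add0n.
  exact: prime_not_scaled_square.
exact: prime_not_scaled_square.
Qed.

Lemma prime_dvd_of_sqr_eq p n m q : prime p -> (n ^ 2 + p * m = p * q)%N -> exists w, n = (p * w)%N.
Proof.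
move=> p_prime E.
have : (p %| n ^ 2)%N by rewrite -(dvdn_addl _ (dvdn_mulr m (dvdnn p))) E dvdn_mulr.
by rewrite Euclid_dvdX // => /andP[/dvdnP[w ->] _]; exists w; rewrite mulnC.
Qed.

Lemma prime_norm3 l x y : prime l -> (4 < l)%N -> ~~ (l %| y)%N ->
    (l %| x ^ 2 + 3 * y ^ 2)%N ->
  exists u v, [/\ (0 < u)%N, (0 < v)%N & l = (1 * u ^ 2 + 3 * v ^ 2)%N].
Proof.
move=> l_prime l_gt4 ndvd_y l_dvd.
suff [u [v def_l]] : exists u v, l = (1 * u ^ 2 + 3 * v ^ 2)%N.
  have := norm_pos l_prime l_gt4 _ _ def_l; case/(_ isT isT)/andP=> u_gt0 v_gt0.
  by exists u, v.
have l6 := prime_mod6 l_prime l_gt4.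
have [u [v [t [E /andP[t_gt0 t_lt]]]]] := thue l_prime (isT : 0 < 3)%N ndvd_y l_dvd.
have {t_gt0 t_lt} : (t = 1 \/ t = 2 \/ t = 3)%N by clear -t_gt0 t_lt; lia.
case=> [|[]] def_t; rewrite def_t in E.
- by exists u, v; rewrite mul1n E mul1n.
(* The case [t = 2] is impossible: [u^2 + 3 v^2] is never 2 modulo 4. *)
- have [p [q [du dv]]] : exists p q, (u = 2 * p + u %% 2 /\ v = 2 * q + v %% 2)%N.
    by exists (u %/ 2)%N, (v %/ 2)%N; clear; lia.
  have lt_u := ltn_pmod u (isT : 0 < 2)%N; have lt_v := ltn_pmod v (isT : 0 < 2)%N.
  move: (u %% 2)%N (v %% 2)%N lt_u lt_v du dv => e f lt_e lt_f du dv.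
  rewrite du dv in E; clear -lt_e lt_f E l6.
  by case: e f lt_e lt_f E => [|[]] // [|[]] // _ _; lia.
have [w def_u] := prime_dvd_of_sqr_eq (isT : prime 3) E.
by exists v, w; rewrite def_u in E; clear -E; lia.
Qed.

Lemma sqr_absz (z : int) : (`|z| ^ 2)%N%:Z = z ^+ 2.
Proof. by rewrite -abszX gez0_abs ?sqr_ge0. Qed.

Lemma sqr_mod5 u v l : (u ^ 2 + 6 * v ^ 2 = 5 * l)%N ->
  exists s : int, u%:Z = 5 * s + 2 * v%:Z \/ u%:Z = 5 * s - 2 * v%:Z.
Proof.
move=> E; have : (5 %| (u%:Z - 2 * v%:Z) * (u%:Z + 2 * v%:Z))%Z.
  apply/dvdzP; exists (l%:Z - 2 * v%:Z ^+ 2).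
  transitivity ((u ^ 2 + 6 * v ^ 2)%N%:Z - 10 * v%:Z ^+ 2).
    by rewrite PoszD !PoszM; ring.
  by rewrite E PoszM; ring.
rewrite (@euclid_dvdz 5) // => /orP[] /dvdzP[s def_s]; exists s; [left | right].
  by transitivity (u%:Z - 2 * v%:Z + 2 * v%:Z); [ring | rewrite def_s; ring].
by transitivity (u%:Z + 2 * v%:Z - 2 * v%:Z); [ring | rewrite def_s; ring].
Qed.

(** The multiples [t = 1, 4, 6] in Thue's lemma descend to the principal form, and [t = 2, 3, 5] to
    the other class of discriminant -24. *)
Lemma prime_norm6 l x y : prime l -> (4 < l)%N -> ~~ (l %| y)%N ->
    (l %| x ^ 2 + 6 * y ^ 2)%N ->
  exists u v, [/\ (0 < u)%N, (0 < v)%N &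
    l = (1 * u ^ 2 + 6 * v ^ 2)%N \/ l = (2 * u ^ 2 + 3 * v ^ 2)%N].
Proof.
move=> l_prime l_gt4 ndvd_y l_dvd.
suff [u [v def_l]] : exists u v,
    l = (1 * u ^ 2 + 6 * v ^ 2)%N \/ l = (2 * u ^ 2 + 3 * v ^ 2)%N.
  have /andP[u_gt0 v_gt0] : (0 < u)%N && (0 < v)%N.
    by case: def_l => def_l; apply: norm_pos def_l.
  by exists u, v.
have [u [v [t [E /andP[t_gt0 t_lt]]]]] := thue l_prime (isT : 0 < 6)%N ndvd_y l_dvd.
have {t_gt0 t_lt} : (t = 1 \/ t = 2 \/ t = 3 \/ t = 4 \/ t = 5 \/ t = 6)%N.
  by clear -t_gt0 t_lt; lia.
case=> [|[|[|[|[]]]]] def_t; rewrite {t}def_t in E.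
- by exists u, v; left; rewrite mul1n E mul1n.
- have E' : (u ^ 2 + 2 * (3 * v ^ 2) = 2 * l)%N by clear -E; lia.
  have [w def_u] := prime_dvd_of_sqr_eq (isT : prime 2) E'.
  by exists w, v; right; rewrite def_u in E; clear -E; lia.
- have E' : (u ^ 2 + 3 * (2 * v ^ 2) = 3 * l)%N by clear -E; lia.
  have [w def_u] := prime_dvd_of_sqr_eq (isT : prime 3) E'.
  by exists v, w; right; rewrite def_u in E; clear -E; lia.
- have E' : (u ^ 2 + 2 * (3 * v ^ 2) = 2 * (2 * l))%N by clear -E; lia.
  have [w def_u] := prime_dvd_of_sqr_eq (isT : prime 2) E'.
  have E'' : (v ^ 2 + 2 * (w ^ 2 + v ^ 2) = 2 * l)%N.
    by rewrite def_u in E; clear -E; lia.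
  have [z def_v] := prime_dvd_of_sqr_eq (isT : prime 2) E''.
  by exists w, z; left; rewrite def_u def_v in E; clear -E; lia.
(* For [t = 5], the sign in [u = 5 s + 2 v] or [u = 5 s - 2 v] carries over to
   [l = 2 (v + s)^2 + 3 s^2] or [l = 2 (v - s)^2 + 3 s^2]. *)
- have [s [def_u|def_u]] : exists s : int,
      u%:Z = 5 * s + 2 * v%:Z \/ u%:Z = 5 * s - 2 * v%:Z.
    exact: sqr_mod5 E.
    exists `|(v%:Z + s)%R|%N, `|s|%N; right; apply/eqP.
    rewrite -eqz_nat PoszD [Posz (2 * _)]PoszM [Posz (3 * _)]PoszM !sqr_absz -(inj_eq (mulfI (_ : 5 != 0 :> int))) //.
    by rewrite -[5 * _]PoszM -E PoszD !PoszM def_u; apply/eqP; ring.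
  exists `|(v%:Z - s)%R|%N, `|s|%N; right; apply/eqP.
  rewrite -eqz_nat PoszD [Posz (2 * _)]PoszM [Posz (3 * _)]PoszM !sqr_absz -(inj_eq (mulfI (_ : 5 != 0 :> int))) //.
  by rewrite -[5 * _]PoszM -E PoszD !PoszM def_u; apply/eqP; ring.
have E' : (u ^ 2 + 2 * (3 * v ^ 2) = 2 * (3 * l))%N by clear -E; lia.
have [w def_u] := prime_dvd_of_sqr_eq (isT : prime 2) E'.
have E'' : (u ^ 2 + 3 * (2 * v ^ 2) = 3 * (2 * l))%N by clear -E; lia.
have [z def_u'] := prime_dvd_of_sqr_eq (isT : prime 3) E''.
have [s def_u6] : exists s, u = (6 * s)%N.
  by exists (u %/ 6)%N; clear -def_u def_u'; lia.
by exists v, s; left; rewrite def_u6 in E; clear -E; lia.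
Qed.

(** * Parity of the numbers of representations *)

Lemma nreps_odd_ex D l k : prime l -> (0 < D)%N -> ~~ (l %| k)%N -> ~~ (l %| D)%N ->
    odd (nreps D (l * k)) ->
  exists x y, ~~ (l %| y)%N && (l %| x ^ 2 + D * y ^ 2)%N.
Proof.
move=> l_prime D_gt0 ndvd_k ndvd_D; rewrite nreps_size.
case Es: (rep_list _ _) => [|[x y] s] // _.
have := mem_head (x, y) s; rewrite -Es mem_rep_list // => /and3P[_ _ /eqP E].
exists x, y; rewrite E dvdn_mulr // andbT; apply: contra ndvd_k => dvd_y.
have dvd_x : (l %| x)%N.
  have : (l %| x ^ 2)%N.
    rewrite -(dvdn_addl _ (dvdn_mull D (dvdn_exp (isT : 0 < 2) dvd_y)))%N E.
    exact: dvdn_mulr.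
  by rewrite Euclid_dvdX // => /andP[].
rewrite -(dvdn_pmul2l (prime_gt0 l_prime)) -E.
by apply: dvdn_add; [|apply: dvdn_mull]; rewrite expnS expn1 dvdn_mul.
Qed.

Lemma prime_coprime6 l : prime l -> (4 < l)%N -> coprime l 6.
Proof.
move=> l_prime l_gt4; rewrite -coprime_modl.
by case: (prime_mod6 l_prime l_gt4) => ->.
Qed.

Lemma scaled_square_neq c k : (1 < c)%N -> (c %| 6)%N -> coprime k 6 ->
  forall w, (c * w ^ 2)%N <> k.
Proof.
move=> c_gt1 dvd_c cop w def_k.
have : (c %| gcdn k 6)%N by rewrite dvdn_gcd dvd_c -def_k dvdn_mulr.
by rewrite (eqP cop) dvdn1 gtn_eqF.
Qed.

Lemma coprime_ndvd c n : (1 < c)%N -> (c %| 6)%N -> coprime n 6 -> ~~ (c %| n)%N.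
Proof.
move=> c_gt1 dvd_c cop; apply/negP => dvd_n.
have : (c %| gcdn n 6)%N by rewrite dvdn_gcd dvd_c dvd_n.
by rewrite (eqP cop) dvdn1 gtn_eqF.
Qed.

(** As [l] is odd, exactly one of [u] and [v] is even; it gets halved. *)
Lemma norm3_to_norm12 l u v : odd l -> l = (1 * u ^ 2 + 3 * v ^ 2)%N ->
    (0 < u)%N -> (0 < v)%N ->
  exists s t, [/\ (0 < s)%N, (0 < t)%N &
    l = (1 * s ^ 2 + 12 * t ^ 2)%N \/ l = (4 * s ^ 2 + 3 * t ^ 2)%N].
Proof.
move=> odd_l def_l u_gt0 v_gt0.
have Eu := odd_double_half u; have Ev := odd_double_half v.
move: odd_l; rewrite {1}def_l mul1n oddD oddM !oddX /=.
case: (odd v) Ev => Ev; case: (odd u) Eu => //= Eu _; rewrite add0n in Eu Ev *.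
  exists u./2, v; split=> //; first by rewrite -double_gt0 Eu.
  by right; rewrite def_l -{1}Eu -mul2n; lia.
exists u, v./2; split=> //; first by rewrite -double_gt0 Ev.
by left; rewrite def_l -{1}Ev -mul2n; lia.
Qed.

Lemma coprime_ndvd12 n : coprime n 6 -> ~~ (12 %| n)%N.
Proof.
move=> cop; apply: contra (coprime_ndvd (isT : 1 < 6)%N (isT : 6 %| 6)%N cop).
exact: dvdn_trans.
Qed.

Lemma four_square_neq k : coprime k 6 -> forall w, (4 * w ^ 2)%N <> k.
Proof.
move=> cop w def_k; have := coprime_ndvd (isT : 1 < 2)%N (isT : 2 %| 6)%N cop.
by rewrite -def_k -[4%N]/(2 * 2)%N -mulnA dvdn_mulr.
Qed.

Lemma twelve_square_neq k : coprime k 6 -> forall w, (12 * w ^ 2)%N <> k.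
Proof.
move=> cop w def_k; apply: (@scaled_square_neq 3 k isT isT cop (2 * w)%N).
by rewrite -def_k expnMn mulnA.
Qed.

(** An odd count would provide a solution, so -3 would be a square modulo [l]; then Thue's lemma
    represents [l] and the involution shows the count even. *)
Lemma even_nreps12 l k : prime l -> (4 < l)%N -> ~~ (l %| k)%N -> coprime k 6 ->
  (forall w, (1 * w ^ 2)%N <> k) -> ~~ odd (nreps 12 (l * k)).
Proof.
move=> l_prime l_gt4 ndvd_k cop_k nsq; apply/negP => odd_r; move: (odd_r).
have l_odd : odd l by have [|] := prime_mod6 l_prime l_gt4; lia.
have l_ndvd12 : ~~ (l %| 12)%N.
  rewrite (Euclid_dvdM 2 6) // negb_or gtnNdvd //=; last by lia.
  apply/negP=> dvd_l; have := prime_coprime6 l_prime l_gt4.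
  by rewrite /coprime (gcdn_idPl dvd_l) gtn_eqF // ltnW // ltnW // ltnW.
case/nreps_odd_ex=> // x [y /andP[ndvd_y dvd_l]]; move: odd_r; apply/negP.
have ndvd_2y : ~~ (l %| 2 * y)%N.
  by rewrite Euclid_dvdM // negb_or ndvd_y gtnNdvd // ltnW // ltnW.
have dvd_l3 : (l %| x ^ 2 + 3 * (2 * y) ^ 2)%N by rewrite expnMn mulnA.
have [u [v [u_gt0 v_gt0 def_l]]] := prime_norm3 l_prime l_gt4 ndvd_2y dvd_l3.
have ndvd_lk : ~~ (12 %| l * k)%N.
  by rewrite coprime_ndvd12 // coprimeMl prime_coprime6.
have [s [t [s_gt0 t_gt0 [E|E]]]] := norm3_to_norm12 l_odd def_l u_gt0 v_gt0.
  apply: (even_nreps l_prime l_gt4 ndvd_k s_gt0 t_gt0 _ _ _ E) => //.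
  exact: twelve_square_neq.
apply: (even_nreps l_prime l_gt4 ndvd_k s_gt0 t_gt0 _ _ _ E) => //.
  exact: scaled_square_neq.
exact: four_square_neq.
Qed.

Lemma even_nreps6 l k : prime l -> (4 < l)%N -> ~~ (l %| k)%N -> coprime k 6 ->
  (forall w, (1 * w ^ 2)%N <> k) -> ~~ odd (nreps 6 (l * k)).
Proof.
move=> l_prime l_gt4 ndvd_k cop_k nsq; apply/negP => odd_r; move: (odd_r).
have l_ndvd6 : ~~ (l %| 6)%N.
  apply/negP=> dvd_l; have := prime_coprime6 l_prime l_gt4.
  by rewrite /coprime (gcdn_idPl dvd_l) gtn_eqF // ltnW // ltnW // ltnW.
case/nreps_odd_ex=> // x [y /andP[ndvd_y dvd_l]]; move: odd_r; apply/negP.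
have ndvd_lk : ~~ (6 %| l * k)%N by rewrite coprime_ndvd // coprimeMl prime_coprime6.
have [u [v [u_gt0 v_gt0 [def_l|def_l]]]] := prime_norm6 l_prime l_gt4 ndvd_y dvd_l.
  by apply: (even_nreps l_prime l_gt4 ndvd_k u_gt0 v_gt0 _ _ _ def_l) => //; exact: scaled_square_neq.
by apply: (even_nreps l_prime l_gt4 ndvd_k u_gt0 v_gt0 _ _ _ def_l) => //; exact: scaled_square_neq.
Qed.

Lemma prim_root_Fp l n : prime l -> (n %| l.-1)%N -> exists z : 'F_l, n.-primitive_root z.
Proof.
move=> l_prime dvd_n; have l_gt1 := prime_gt1 l_prime.
pose rs := [seq x <- enum 'F_l | x != 0].
have /hasP[w _ prim_w] : has l.-1.-primitive_root rs.
  apply: has_prim_root; first by rewrite -subn1 subn_gt0.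
  - apply/allP => x; rewrite mem_filter => /andP[x_neq0 _].
    apply/unity_rootP/(mulfI x_neq0).
    by have := expf_card x; rewrite card_Fp // -exprS prednK ?prime_gt0 // mulr1.
  - by rewrite filter_uniq ?enum_uniq.
  have := cardC1 (0 : 'F_l); rewrite card_Fp // => <-.
  rewrite cardE; apply: uniq_leq_size => [|x]; first exact: enum_uniq.
  by rewrite mem_enum inE => x_neq0; rewrite mem_filter x_neq0 mem_enum.
by exists (w ^+ (l.-1 %/ n)); apply: dvdn_prim_root.
Qed.

(** With [z] a primitive 24th root of unity modulo [l], [z^8] is a cube root of unity, giving
    [sqrt(-3) = 2 z^8 + 1], and [z^3] an eighth root, giving [sqrt 2 = z^3 + z^(-3)]. *)
Lemma neg3_neg6_square_mod l : prime l -> (l %% 24 = 1)%N ->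
  exists x y, (l %| x ^ 2 + 3)%N && (l %| y ^ 2 + 6)%N.
Proof.
move=> l_prime l24; have dvd24 : (24 %| l.-1)%N by have := prime_gt0 l_prime; lia.
have [z prim_z] := prim_root_Fp l_prime dvd24.
have z24 := prim_expr_order prim_z.
have z12 : z ^+ 12 = -1.
  have : z ^+ 12 != 1 by rewrite -(prim_order_dvd prim_z).
  have /eqP : (z ^+ 12) ^+ 2 = 1 by rewrite -exprM.
  by rewrite sqrf_eq1 => /orP[->|/eqP].
have w3 : z ^+ 16 + z ^+ 8 + 1 = 0.
  have : z ^+ 8 - 1 != 0 by rewrite subr_eq0 -(prim_order_dvd prim_z).
  move/mulfI; apply; rewrite mulr0.
  by transitivity (z ^+ 24 - 1); [ring | rewrite z24 subrr].
have s3 : (2 * z ^+ 8 + 1) ^+ 2 = - 3.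
  transitivity (4 * (z ^+ 16 + z ^+ 8 + 1) - 3); first by ring.
  by rewrite w3 mulr0 add0r.
have s2 : (z ^+ 3 + z ^+ 21) ^+ 2 = 2.
  transitivity (z ^+ 6 * (1 + z ^+ 12 * z ^+ 24) + 2 * z ^+ 24); first by ring.
  by rewrite z12 z24; ring.
have lift (s : 'F_l) d : s ^+ 2 = - d%:R -> (l %| (s : nat) ^ 2 + d)%N.
  move=> Es; rewrite (dvdn_pcharf (pchar_Fp l_prime)) natrD natrX.
  by rewrite natr_Zp Es addNr.
exists (2 * z ^+ 8 + 1 : 'F_l), ((2 * z ^+ 8 + 1) * (z ^+ 3 + z ^+ 21) : 'F_l).
by rewrite !lift // exprMn s2 s3; ring.
Qed.

Lemma odd_nreps_mod24 l m : prime l -> (l %% 24 = 1)%N -> ~~ (l %| m ^ 2)%N ->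
  coprime (m ^ 2) 6 -> odd (nreps 6 (l * m ^ 2)) && odd (nreps 12 (l * m ^ 2)).
Proof.
move=> l_prime l24 ndvd_m cop_m; have l_gt1 := prime_gt1 l_prime.
have l_gt4 : (4 < l)%N by lia.
have l_odd : odd l by lia.
have ndvd1 : ~~ (l %| 1)%N by rewrite gtnNdvd.
have cop_lm : coprime (l * m ^ 2) 6 by rewrite coprimeMl prime_coprime6.
have [x [y /andP[dvd_x dvd_y]]] := neg3_neg6_square_mod l_prime l24.
rewrite -[3%N]muln1 -(exp1n 2) in dvd_x; rewrite -[6%N]muln1 -(exp1n 2) in dvd_y.
have sqr_mod3 n : exists q, (n ^ 2 = 3 * q \/ n ^ 2 = 3 * q + 1)%N.
  have := divn_eq n 3; move: (n %/ 3)%N (n %% 3)%N (ltn_pmod n (isT : 0 < 3)%N).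
  move=> q r lt_r ->; exists (3 * q * q + 2 * q * r + (r == 2))%N.
  by case: r lt_r => [|[|[|]]] //= _; lia.
have sqr_mod4 n : exists q, (n ^ 2 = 4 * q \/ n ^ 2 = 4 * q + 1)%N.
  have := divn_eq n 2; move: (n %/ 2)%N (n %% 2)%N (ltn_pmod n (isT : 0 < 2)%N).
  by move=> q r lt_r ->; exists (q * q + q * r)%N; case: r lt_r => [|[|]] //= _; lia.
apply/andP; split.
  have [u [v [u_gt0 v_gt0 [E|E]]]] := prime_norm6 l_prime l_gt4 ndvd1 dvd_y.
    apply: (odd_nreps l_prime l_gt4 ndvd_m u_gt0 v_gt0 _ _ _ E) => //.
      exact: coprime_ndvd.
    exact: scaled_square_neq.
  (* The form [2 u^2 + 3 v^2] is excluded modulo 3. *)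
  by have [q] := sqr_mod3 u; clear -E l24; lia.
have [u [v [u_gt0 v_gt0 def_l]]] := prime_norm3 l_prime l_gt4 ndvd1 dvd_x.
have [s [t [s_gt0 t_gt0 [E|E]]]] := norm3_to_norm12 l_odd def_l u_gt0 v_gt0.
  apply: (odd_nreps l_prime l_gt4 ndvd_m s_gt0 t_gt0 _ _ _ E) => //.
    exact: coprime_ndvd12.
  exact: twelve_square_neq.
(* The form [4 s^2 + 3 t^2] is excluded modulo 4. *)
by have [q] := sqr_mod4 t; clear -E l24; lia.
Qed.

Lemma nreps_mod24_19 M : (M %% 24 = 19)%N -> nreps 6 M = 0%N /\ nreps 12 M = 0%N.
Proof.
move=> M24; have sqr_mod24 n : exists q r, (n ^ 2 = 24 * q + r)%N /\
    r \in [:: 0; 1; 4; 9; 12; 16]%N.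
  have := divn_eq n 12; move: (n %/ 12)%N (n %% 12)%N (ltn_pmod n (isT : 0 < 12)%N).
  move=> q r lt_r ->; exists (6 * q * q + q * r + r ^ 2 %/ 24)%N, (r ^ 2 %% 24)%N.
  split; first by rewrite -addnA addnA; have := divn_eq (r ^ 2) 24; lia.
  by case: r lt_r => [|[|[|[|[|[|[|[|[|[|[|[|]]]]]]]]]]]].
have sqr_mod4 n : exists q, (n ^ 2 = 4 * q \/ n ^ 2 = 4 * q + 1)%N.
  have := divn_eq n 2; move: (n %/ 2)%N (n %% 2)%N (ltn_pmod n (isT : 0 < 2)%N).
  by move=> q r lt_r ->; exists (q * q + q * r)%N; case: r lt_r => [|[|]] //= _; lia.
split; rewrite nreps_size; apply/eqP; rewrite size_eq0.
  case Es: (rep_list _ _) => [//|[x y] s].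
  have := mem_head (x, y) s; rewrite -Es mem_rep_list // => /and3P[_ _ /eqP E].
  have [q [r [Ex]]] := sqr_mod24 x; have [q' Ey] := sqr_mod4 y.
  by rewrite !inE; clear -E Ex Ey M24; lia.
case Es: (rep_list _ _) => [//|[x y] s].
have := mem_head (x, y) s; rewrite -Es mem_rep_list // => /and3P[_ _ /eqP E].
have [q [r [Ex]]] := sqr_mod24 x; have [q' Ey] := sqr_mod4 y.
by rewrite !inE; clear -E Ex Ey M24; lia.
Qed.

Lemma coprime6_sqr_mod24 w : coprime (w ^ 2) 6 -> exists q, (w ^ 2 = 24 * q + 1)%N.
Proof.
rewrite coprime_pexpl // coprime6E.
have := divn_eq w 12; move: (w %/ 12)%N (w %% 12)%N (ltn_pmod w (isT : 0 < 12)%N).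
move=> q r lt_r -> w6; exists (6 * q * q + q * r + r ^ 2 %/ 24)%N.
have {w6}: ((r %% 6 == 1) || (r %% 6 == 5))%N by move: w6; lia.
by case: r lt_r => [|[|[|[|[|[|[|[|[|[|[|[|]]]]]]]]]]]] //= _ _; lia.
Qed.

(** * The congruence for ou* *)

(** [M = l k] is not a square, as [l] divides it exactly once. If [k] is a square, it is 1 modulo
    24, so [l] is congruent to [6 L + 1], that is to 1, 7, 13 or 19; otherwise both counts are
    even. *)
Lemma ou_star_eq0_mod4 l k L : prime l -> (4 < l)%N -> (l * k = 6 * L + 1)%N ->
    ~~ (l %| k)%N ->
    (forall w, (1 * w ^ 2)%N <> k) \/ ~ (l %% 24 = 7 \/ l %% 24 = 13)%N ->
  (ou_star (4 * L + 1)%N %% 4 = 0)%N.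
Proof.
move=> l_prime l_gt4 def_M ndvd_k cond.
have cop_M : coprime (l * k) 6 by rewrite coprime6E def_M; lia.
have cop_k : coprime k 6 by move: cop_M; rewrite coprimeMl => /andP[].
have M_nonsquare w : (w ^ 2 <> l * k)%N.
  move=> def_w; have : (l %| w ^ 2)%N by rewrite def_w dvdn_mulr.
  rewrite Euclid_dvdX // andbT => /dvdnP[z def_z].
  move/negP: ndvd_k; apply; apply/dvdnP; exists (z ^ 2)%N; apply/eqP.
  by rewrite -(eqn_pmul2l (prime_gt0 l_prime)) -def_w def_z; apply/eqP; ring.
have even_sum : ~~ odd (nreps 6 (l * k) + nreps 12 (l * k)).
  have [/existsP[[m lt_m] /= /eqP def_k]|nsq] := boolP [exists m : 'I_k.+1, m ^ 2 == k]%N.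
    case: cond => [nsq|l24]; first by case: (nsq m); rewrite mul1n.
    have [q def_kq] : exists q, k = (24 * q + 1)%N.
      by rewrite -def_k; apply: coprime6_sqr_mod24; rewrite def_k.
    have lM24 : (l * k %% 24 = l %% 24)%N.
      by rewrite def_kq mulnDr muln1 mulnCA [(24 * _)%N]mulnC modnMDl.
    have l24' : (l %% 24 = 1 \/ l %% 24 = 19)%N.
      by clear -l24 lM24 def_M; lia.
    case: l24' => l24'.
      rewrite -def_k in ndvd_k cop_k *.
      have /andP[odd6 odd12] := odd_nreps_mod24 l_prime l24' ndvd_k cop_k.
      by rewrite oddD odd6 odd12.
    rewrite l24' in lM24.
    by have [-> ->] := nreps_mod24_19 lM24.
  have {}nsq w : (1 * w ^ 2)%N <> k.
    move=> def_k; move/negP: nsq; apply; apply/existsP.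
    have lt_w : (w < k.+1)%N by rewrite -def_k; nia.
    by exists (Ordinal lt_w); rewrite /= -def_k mul1n.
  by rewrite oddD (negbTE (even_nreps6 _ _ _ _ _)) // (negbTE (even_nreps12 _ _ _ _ _)).
have lt_KM : ((2 * L).*2.+1 < (l * k).+1)%N by rewrite def_M; lia.
have [r1 E1] := ou_star_mod4 lt_KM; have [r2 E2] := nu_coef_mod4 def_M M_nonsquare.
have -> : (4 * L + 1 = (2 * L).*2.+1)%N by lia.
move: E1; rewrite E2; move: even_sum; clear.
move: (ou_star _) (_ + _)%N => a b; lia.
Qed.

(** The relation between [e] and the odd [k] makes [l k = 6 L + 1] and [e = 4 L + 1]. As [k] is
    [3 j] modulo [l], a square [k] would contradict a Legendre symbol of -1. *)
Lemma ou_star_progression l (j k e : int) : prime l -> (5 <= l)%N ->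
  ((l = 7 %[mod 24] \/ l = 13 %[mod 24]) /\ legendre (3 * j) l = -1) \/
  (~ (l = 7 %[mod 24] \/ l = 13 %[mod 24]) /\ ~ (l %| j)%Z) ->
  ~ (2 %| k)%Z -> (l %| k - 3 * j)%Z -> 3 * e = 2 * l%:Z * k + 1 ->
  ou_star e = 0 %[mod 4].
Proof.
move=> l_prime l_gt4 hyp odd_k l_dvd def_e.
(* [ou_star] is 0 at negative weights; [e >= 0] then rules out a negative [k]. *)
case: e def_e => // e def_e; rewrite mod0n.
have l_gt0 := prime_gt0 l_prime.
case: k odd_k l_dvd def_e => k odd_k l_dvd def_e; last first.
  have lk_gt0 : (0 < l * k.+1)%N by rewrite muln_gt0 l_gt0.
  have E : 3 * e%:Z + 2 * (l * k.+1)%N%:Z = 1.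
    by rewrite def_e NegzE PoszM; ring.
  by exfalso; clear -E lk_gt0; move: (l * k.+1)%N lk_gt0 E => m; lia.
have [L [def_M def_L]] : exists L, (l * k = 6 * L + 1 /\ e = 4 * L + 1)%N.
  have odd_l : odd l by case: (prime_mod6 l_prime l_gt4); clear; lia.
  have odd_M : odd (l * k) by rewrite oddM odd_l /=; clear -odd_k; lia.
  exists (l * k %/ 6)%N; clear -def_e odd_M.
  have {}def_e : (3 * e = 2 * (l * k) + 1)%N by lia.
  by move: (l * k)%N odd_M def_e => M odd_M def_e; lia.
have l_ndvd3 : (l %| 3)%Z = false by rewrite dvdzE gtnNdvd //; apply: ltnW.
have dvd_kj : (l %| k)%N = (l %| j)%Z.
  rewrite -[(l %| k)%N]/(l %| k%:Z)%Z -[k%:Z](subrK (3 * j)) rpredDl //.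
  by rewrite euclid_dvdz // l_ndvd3.
rewrite def_L; apply: (ou_star_eq0_mod4 l_prime l_gt4 def_M).
  rewrite dvd_kj; case: hyp => [[_]|[_ /negP]//].
  rewrite /legendre euclid_dvdz // l_ndvd3 /=.
  by case: (l %| j)%Z.
case: hyp => [[_ leg]|[l24' _]]; [left | right]; last first.
  by move=> l24; apply: l24'; case: l24 => ->; [left | right].
move=> w def_k; move: leg; rewrite /legendre; case: ifP => // _.
case: existsP => // -[]; exists (Ordinal (ltn_pmod w l_gt0)) => /=.
rewrite -modz_nat modzXm eqz_mod_dvd.
by move: l_dvd; rewrite -def_k mul1n PoszM -expr2.
Qed.

Theorem theorem1p5 (l : nat) (j : int) :
  prime l -> (5 <= l)%N ->
  ((l = 7 %[mod 24] \/ l = 13 %[mod 24]) /\ legendre (3 * j) l = -1) \/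
  (~ (l = 7 %[mod 24] \/ l = 13 %[mod 24]) /\ ~ (l %| j)%Z) ->
  forall n : int, 0 <= n ->
    (~ (2 %| j)%Z ->
      ou_star (4 * l%:Z ^+ 2 * n + 2 * j * l%:Z
               + ((8 * l%:Z ^+ 2 + 1) %/ 3)%Z) = 0 %[mod 4]) /\
    ((2 %| j)%Z ->
      ou_star (4 * l%:Z ^+ 2 * n + 2 * j * l%:Z
               + ((2 * l%:Z ^+ 2 + 1) %/ 3)%Z) = 0 %[mod 4]).
Proof.
move=> l_prime l_ge5 hyp n _.
have [t def_t] : exists t : int, l%:Z ^+ 2 = 3 * t + 1.
  have cop_l2 : coprime (l ^ 2) 6 by rewrite coprime_pexpl // prime_coprime6.
  have [q def_q] := coprime6_sqr_mod24 cop_l2.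
  exists (8 * q%:Z); transitivity (l ^ 2)%N%:Z; first by rewrite PoszM -expr2.
  by rewrite def_q PoszD PoszM; ring.
have odd_l : ~ (2 %| l%:Z)%Z by case: (prime_mod6 l_prime l_ge5); clear; lia.
split=> parity_j.
  (* This [k] solves [3 e = 2 l k + 1] for the weight at hand; it is odd because [j] is. *)
  apply: (@ou_star_progression l j (6 * l%:Z * n + 3 * j + 4 * l%:Z)) => //.
  - move=> dvd_k; apply: parity_j.
    have -> : j = 6 * l%:Z * n + 3 * j + 4 * l%:Z - 2 * (3 * l%:Z * n + j + 2 * l%:Z).
      by ring.
    by apply: rpredB => //; apply: dvdz_mulr.
  - by apply/dvdzP; exists (6 * n + 4); ring.
  have -> : ((8 * l%:Z ^+ 2 + 1) %/ 3)%Z = 8 * t + 3 by rewrite def_t; lia.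
  transitivity (12 * l%:Z ^+ 2 * n + 6 * l%:Z * j + 8 * (3 * t + 1) + 1); first by ring.
  by rewrite -def_t; ring.
(* The same equation; now [k] is odd because [l] is odd and [j] even. *)
apply: (@ou_star_progression l j (6 * l%:Z * n + 3 * j + l%:Z)) => //.
- move=> dvd_k; apply: odd_l.
  have -> : l%:Z = 6 * l%:Z * n + 3 * j + l%:Z - 2 * (3 * l%:Z * n) - 3 * j by ring.
  by rewrite !rpredB //; [apply: dvdz_mulr | apply: dvdz_mull].
- by apply/dvdzP; exists (6 * n + 1); ring.
have -> : ((2 * l%:Z ^+ 2 + 1) %/ 3)%Z = 2 * t + 1 by rewrite def_t; lia.
transitivity (12 * l%:Z ^+ 2 * n + 6 * l%:Z * j + 2 * (3 * t + 1) + 1); first by ring.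
by rewrite -def_t; ring.
Qed.
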